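(* Let $m>1$. Assume $\beta_c>0$ is a discontinuous transition point of $\mathcal F_\beta^m$ and that for some family $\{\rho_\beta\}_{\beta>\beta_c}$, with $\rho_\beta$ a minimiser of $\mathcal F_\beta^m$, $$\limsup_{\beta\to\beta_c^+}\|\rho_\beta-\rho_\infty\|_{L^\infty(\Omega)}\ne0.$$ Then there exists $\rho_{\beta_c}\in\mathcal P(\Omega)$, $\rho_{\beta_c}\ne\rho_\infty$, such that: (1) $\min_{\rho\in\mathcal P(\Omega)}\mathcal F_{\beta_c}^m(\rho)=\mathcal F_{\beta_c}^m(\rho_{\beta_c})=\mathcal F_{\beta_c}^m(\rho_\infty)$; (2) $S_{\beta_c}^m(\rho_{\beta_c})>S_{\beta_c}^m(\rho_\infty)$ and $\mathcal E(\rho_{\beta_c})<\mathcal E(\rho_\infty)=0$.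
   Context: $\Omega=\mathbb T^d$ is the torus of side length $L>0$, $\rho_\infty:=L^{-d}=|\Omega|^{-1}$; $\mathcal P(\Omega)$ is the set of Borel probability measures on $\Omega$, identified with their densities when these exist. $W\in C^2(\Omega)$ is even along every coordinate and has mean zero. For $m>1$, $\mathcal F_\beta^m(\rho)=S_\beta^m(\rho)+\mathcal E(\rho)$ with $$S_\beta^m(\rho)=\frac{\beta^{-1}}{m-1}\int_\Omega\rho^m\,dx-\frac{\beta^{-1}}{m-1},\qquad \mathcal E(\rho)=\frac12\iint_{\Omega\times\Omega}W(x-y)\rho(x)\rho(y)\,dx\,dy$$ whenever these quantities are finite, and $\mathcal F_\beta^m(\rho)=+\infty$ otherwise; ''minimiser'' means minimiser over $\mathcal P(\Omega)$. Transition point: $\beta_c>0$ is a transition point of $\mathcal F_\beta^m$ if (i) for $\beta<\beta_c$, $\rho_\infty$ is the unique minimiser of $\mathcal F_\beta^m$; (ii) at $\beta=\beta_c$, $\rho_\infty$ is a minimiser; (iii) for every $\beta>\beta_c$ there exists a minimiser $\rho_\beta\neq\rho_\infty$ of $\mathcal F_\beta^m$. It is continuous if (a) $\rho_\infty$ is the unique minimiser of $\mathcal F_{\beta_c}^m$, and (b) for any family $\{\rho_\beta\}_{\beta>\beta_c}$ of minimisers, $\limsup_{\beta\to\beta_c^+}\|\rho_\beta-\rho_\infty\|_{L^\infty(\Omega)}=0$; it is discontinuous if it is not continuous. *)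

(* Defs.v *)
From HB Require Import structures.
From mathcomp Require Import all_boot all_order all_algebra.
From mathcomp Require Import all_classical all_reals all_analysis giry.

Set Implicit Arguments.
Unset Strict Implicit.
Unset Printing Implicit Defensive.

Import Order.TTheory GRing.Theory Num.Theory.
Import numFieldNormedType.Exports.

Local Open Scope classical_set_scope.
Local Open Scope ring_scope.

(* The torus R^d / L Z^d is represented by its fundamental cell [0, L[^d: a
   Borel measure on the torus is a Borel measure on R^d carried by the cell, and
   a function on the torus is a function on 'rV[R]_d that is L-periodic in every
   coordinate.  Measure theory takes place on d-tuples, whose sigma-algebra is
   the product one; measurableTypeR R is R with the Borel sigma-algebra on which
   lebesgue_measure is defined. *)
Definition Rd (R : realType) (d : nat) := (d.-tuple (measurableTypeR R))%type.

HB.instance Definition _ (R : realType) (d : nat) := Measurable.on (Rd R d).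

Definition vec (R : realType) (d : nat) (x : Rd R d) : 'rV[R]_d :=
  \row_i (tnth x i : R).

Definition cell (R : realType) (L : {posnum R}) (d : nat) : set (Rd R d) :=
  [set x | forall i, (0 <= (tnth x i : R) < L%:num)%R].
Arguments cell {R} L d _.

Section circle.
Context {R : realType} (L : {posnum R}).

Lemma measurable_itv0L :
  measurable (`[0, L%:num[%classic : set (measurableTypeR R)).
Proof. exact: measurable_itv. Qed.

Lemma lebesgue_itv0L :
  lebesgue_measure (`[0, L%:num[%classic : set (measurableTypeR R)) =
  (L%:num)%:E.
Proof. by rewrite lebesgue_measure_itv/= lte_fin gt0 sube0. Qed.

Lemma lebesgue_itv0L_lty :
  (lebesgue_measure (`[0%R, (L%:num)%R[%classic : set (measurableTypeR R))
    < +oo)%E.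
Proof. by rewrite lebesgue_itv0L ltry. Qed.

Definition circle_leb : set (measurableTypeR R) -> \bar R :=
  mfrestr measurable_itv0L lebesgue_itv0L_lty.

HB.instance Definition _ := FiniteMeasure.on circle_leb.

Lemma circle_lebE A : circle_leb A = lebesgue_measure (A `&` `[0, L%:num[).
Proof. by []. Qed.

End circle.

Definition Rd_cons (R : realType) n (p : measurableTypeR R * Rd R n) :
  Rd R n.+1 := [tuple of p.1 :: p.2].

Lemma measurable_Rd_cons (R : realType) n :
  measurable_fun [set: measurableTypeR R * Rd R n] (@Rd_cons R n).
Proof. exact: measurable_cons. Qed.

Section cons_measure.
Context {R : realType} {n : nat}.
Variable mu : {finite_measure set (measurableTypeR R) -> \bar R}.
Variable nu : {finite_measure set (Rd R n) -> \bar R}.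

Definition cons_measure : set (Rd R n.+1) -> \bar R :=
  pushforward (mu \x nu)%E (@Rd_cons R n).

Let push : {measure set (Rd R n.+1) -> \bar R} :=
  measure_function_pushforward__canonical__measure_function_Measure
    (mu \x nu)%E (@measurable_Rd_cons R n).

HB.instance Definition _ := isMeasure.Build _ _ _ cons_measure
  (measure0 push) (measure_ge0 push) (@measure_semi_sigma_additive _ _ _ push).

Lemma cons_measureT :
  cons_measure setT = (mu setT * nu setT)%E.
Proof.
by rewrite /cons_measure /pushforward preimage_setT -setXTT product_measure1E.
Qed.

Let cons_measure_fin : fin_num_fun cons_measure.
Proof.
apply: lty_fin_num_fun; rewrite -[ltLHS]/(cons_measure setT) cons_measureT.
by rewrite lte_mul_pinfty// ?ltry_fin_num// -?ge0_fin_numE// fin_num_measure.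
Qed.

HB.instance Definition _ :=
  Measure_isFinite.Build _ _ _ cons_measure cons_measure_fin.

End cons_measure.

Section torus.
Context {R : realType} (L : {posnum R}).

(* Lebesgue measure of R^d restricted to the cell [0, L[^d *)
Fixpoint torus_leb (d : nat) : {finite_measure set (Rd R d) -> \bar R} :=
  if d is d'.+1 return {finite_measure set (Rd R d) -> \bar R}
  then cons_measure (circle_leb L) (torus_leb d')
  else dirac ([tuple] : Rd R 0).

Lemma measurable_box d (B : 'I_d -> set (measurableTypeR R)) :
  (forall i, measurable (B i)) ->
  measurable [set x : Rd R d | forall i, B i (tnth x i)].
Proof.
move=> mB; rewrite (_ : mkset _ =
    \bigcap_(i in [set: 'I_d]) ((fun x : Rd R d => tnth x i) @^-1` B i)).
  apply: fin_bigcap_measurable => // i _.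
    rewrite -[X in measurable X]setTI; exact: (@measurable_tnth _ (measurableTypeR R) d i measurableT (B i) (mB i)).
by apply/seteqP; split => [x H i _|x H i]; exact: H.
Qed.

Lemma torus_leb_box d (B : 'I_d -> set (measurableTypeR R)) :
  (forall i, measurable (B i)) ->
  torus_leb d [set x | forall i, B i (tnth x i)] =
  (\prod_(i < d) lebesgue_measure (B i `&` `[0%R, (L%:num)%R[))%E.
Proof.
elim: d B => [|d IH] B mB.
  rewrite big_ord0 /= diracE mem_set//.
  by case.
rewrite big_ord_recl /= /cons_measure /pushforward.
rewrite (_ : _ @^-1` _ =
  B ord0 `*` [set x | forall i, B (lift ord0 i) (tnth x i)]); last first.
  apply/seteqP; split => [[x y] /= H|[x y] /= [H0 H1] i].
    split; first exact: (H ord0).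
    by move=> i; have := H (lift ord0 i); rewrite tnthS.
  by case: (unliftP ord0 i) => [j ->|->//]; rewrite tnthS; exact: H1.
rewrite product_measure1E//.
  by congr (_ * _)%E; exact: (IH (fun i => B (lift ord0 i))).
exact: (@measurable_box d (fun i => B (lift ord0 i))).
Qed.

Lemma torus_lebT d : torus_leb d setT = ((L%:num) ^+ d)%:E.
Proof.
have := @torus_leb_box d (fun=> setT) (fun=> measurableT).
rewrite (_ : [set x | _] = setT); last by apply/seteqP; split.
move=> ->; rewrite (eq_bigr (fun=> (L%:num)%:E)); last first.
  by move=> i _; rewrite setTI lebesgue_itv0L.
by rewrite prodEFin prodr_const card_ord.
Qed.

Definition rho_inf (d : nat) : set (Rd R d) -> \bar R :=
  mscale ((L%:num) ^- d)%:nng (torus_leb d).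
Arguments rho_inf : clear implicits.

HB.instance Definition _ d := Measure.on (rho_inf d).

Lemma rho_infT d : rho_inf d setT = 1%E.
Proof.
have -> : rho_inf d setT = ((L%:num ^- d)%:E * torus_leb d setT)%E by [].
by rewrite torus_lebT -EFinM mulVf// expf_neq0.
Qed.

HB.instance Definition _ d :=
  Measure_isProbability.Build _ _ _ (rho_inf d) (rho_infT d).

End torus.
Arguments torus_leb {R} L d.
Arguments rho_inf {R} L d _.

Section potential.
Context {R : realType} {d : nat}.
Implicit Type W : 'rV[R]_d -> R.

Definition torus_periodic (L : {posnum R}) W :=
  forall (i : 'I_d) x, W (x + L%:num *: delta_mx ord0 i) = W x.

Definition C2 W :=
  continuous W /\
  forall i : 'I_d, let Wi := 'D_(delta_mx ord0 i) W in
    [/\ forall x, derivable W x (delta_mx ord0 i),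
        continuous Wi &
        forall j : 'I_d,
          (forall x, derivable Wi x (delta_mx ord0 j)) /\
          continuous ('D_(delta_mx ord0 j) Wi)].

Definition flip (i : 'I_d) (x : 'rV[R]_d) : 'rV[R]_d :=
  \row_j (if j == i then - x ord0 j else x ord0 j).

Definition even_coord W := forall (i : 'I_d) x, W (flip i x) = W x.

Definition mean_zero (L : {posnum R}) W :=
  (\int[torus_leb L d]_x (W (vec x))%:E = 0)%E.

End potential.

Section free_energy.
Context {R : realType} {d : nat} (L : {posnum R}) (W : 'rV[R]_d -> R) (m : R).
Local Open Scope charge_scope.
Local Open Scope ereal_scope.
Implicit Types (rho nu : probability (Rd R d) R) (beta : R).

Definition in_P rho : Prop := rho (cell L d) = 1.

(* Only meaningful when rho `<< torus_leb L d.  A measure without a density has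
   S_ = +oo, hence F_ = +oo, so the junk value does not reach F_. *)
Definition density rho : Rd R d -> \bar R :=
  'd (charge_of_finite_measure rho) '/d (torus_leb L d).

Definition S_ beta rho : \bar R :=
  if `[< rho `<< torus_leb L d >] then
    (beta^-1 / (m - 1))%:E * \int[torus_leb L d]_x (density rho x `^ m)
      - (beta^-1 / (m - 1))%:E
  else +oo.

Definition E_ rho : \bar R :=
  (2^-1)%:E * \int[torus_leb L d \x torus_leb L d]_z
     ((W (vec z.1 - vec z.2))%:E * density rho z.1 * density rho z.2).

Definition F_ beta rho : \bar R :=
  if (S_ beta rho \is a fin_num) && (E_ rho \is a fin_num)
  then S_ beta rho + E_ rho else +oo.

Definition minimiser beta rho : Prop :=
  in_P rho /\ forall nu, in_P nu -> F_ beta rho <= F_ beta nu.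

(* Measures are compared with measure_eq, i.e. on measurable sets: the value of
   a measure on other sets is unconstrained. *)
Definition unique_minimiser beta rho : Prop :=
  minimiser beta rho /\ forall nu, minimiser beta nu -> nu ≡μ rho.

Definition minimiser_family betac (rho_ : R -> probability (Rd R d) R) : Prop :=
  forall beta, (betac < beta)%R -> minimiser beta (rho_ beta).

Definition Linfty_dist rho : \bar R :=
  'N[torus_leb L d]_+oo [(fun x => density rho x - (L%:num ^- d)%:E)].

Definition limsup_dist betac (rho_ : R -> probability (Rd R d) R) : \bar R :=
  limf_esup (fun beta => Linfty_dist (rho_ beta)) betac^'+.

Definition transition_point betac : Prop :=
  [/\ (0 < betac)%R,
      forall beta, (0 < beta < betac)%R -> unique_minimiser beta (rho_inf L d),
      minimiser betac (rho_inf L d) &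
      forall beta, (betac < beta)%R ->
        exists rho, minimiser beta rho /\ ~ (rho ≡μ rho_inf L d)].

Definition continuous_transition_point betac : Prop :=
  [/\ transition_point betac,
      unique_minimiser betac (rho_inf L d) &
      forall rho_ : R -> probability (Rd R d) R,
        minimiser_family betac rho_ -> limsup_dist betac rho_ = 0].

Definition discontinuous_transition_point betac : Prop :=
  transition_point betac /\ ~ continuous_transition_point betac.

End free_energy.

(* Main.v *)
Require Import Defs.
From HB Require Import structures.
From mathcomp Require Import all_boot all_order all_algebra.
From mathcomp Require Import all_classical all_reals all_analysis giry.
From mathcomp Require Import measurable_realfun ess_sup_inf.
From mathcomp Require Import ring lra.

(** A nonuniform minimiser at the transition point is found as a limit of the
    minimisers rho_beta as beta decreases to betac.

    A weak limit would not do: a priori it could be uniform although the rho_beta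
    stay far from uniform in the supremum norm.  The Euler-Lagrange equation
    (euler_lagrange) provides a stronger compactness: if f is the density of a
    minimiser and V = W * f its potential, then almost everywhere
    f = ((C - V)_+ / (a m)) ^ (1 / (m - 1)) with a = beta^-1 / (m - 1).  It is
    obtained without differentiating the entropy.  Comparing f with
    (1 - t) f + t g and using convexity shows that f minimises the linearised
    functional a * int g ^ m + int V g (linearised_minimality); the right-hand
    side above, with C fixed by the mass constraint (best_density_mass),
    minimises its integrand strictly at each point, so f must coincide with it.

    The potentials V inherit a modulus of continuity from W, and the constants C
    are bounded, so the right-hand sides are equicontinuous and bounded uniformly
    for beta near betac.  By the Arzela-Ascoli theorem some sequence of
    minimisers, chosen to stay away from the uniform density, has densities
    converging uniformly to some h (minimisers_precompact).  All energies pass to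
    the limit (energy_cvg), so h does at least as well as the uniform density at
    betac, which is itself a minimiser; hence h is a minimiser too, with the same
    free energy, and uniform convergence keeps it different from the uniform
    density.

    The strict comparison of the entropies is the equality case of Jensen's
    inequality for s |-> s ^ m (powR_strict_jensen).  The comparison of the
    interaction energies follows by subtraction; that of the uniform density
    vanishes because W has mean zero and Lebesgue measure on the torus is
    translation invariant (torus_shift). *)

Set Implicit Arguments.
Unset Strict Implicit.
Unset Printing Implicit Defensive.

Import Order.TTheory GRing.Theory Num.Theory.
Import numFieldNormedType.Exports.

Local Open Scope classical_set_scope.
Local Open Scope ring_scope.

(** * Convexity of real powers *)

Section real_power.
Context {R : realType}.
Implicit Types (m p a u s r t x : R).

Lemma ln_lt_subr1 x : 0 < x -> x != 1 -> ln x < x - 1.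
Proof.
move=> x0 x1; have l0 : ln x != 0 by rewrite ln_eq0.
by have := expR_gt1Dx l0; rewrite lnK ?posrE// -ltrBrDl.
Qed.

(** Strict Bernoulli inequality.  With y = t ^ m and A = 1 + (y - 1) / m, the
    weighted mean of y and 1 for the weights 1/m and 1 - 1/m, adding up the
    bounds ln x <= x - 1 at y / A and at 1 / A gives ln t < ln A. *)
Lemma powR_bernoulli m t : 1 < m -> 0 <= t -> t != 1 ->
  1 + m * (t - 1) < t `^ m.
Proof.
move=> m1; have m0 : 0 < m by apply: lt_trans m1.
rewrite le_eqVlt => /predU1P[<- _|t0 t1].
  by rewrite powR0 ?gt_eqF//; lra.
have y0 : 0 < t `^ m by exact: powR_gt0.
have : ln (t `^ m) = m * ln t by rewrite ln_powR.
have : t `^ m != 1.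
  by rewrite powR_eq1 (negbTE t1) ltNge (ltW t0)/= gt_eqF.
move: (t `^ m) y0 => y y0 y1 lny.
have [A AE] : exists A, A = 1 + (y - 1) / m by eexists.
have A0 : 0 < A.
  have -> : A = (m - 1 + y) / m by rewrite AE; field; rewrite gt_eqF.
  by rewrite divr_gt0//; lra.
have A1 : A != 1.
  rewrite -subr_eq0 (_ : A - 1 = (y - 1) / m); last by rewrite AE; ring.
  by rewrite mulf_neq0 ?subr_eq0// invr_neq0// gt_eqF.
have e1 : ln (y / A) <= y / A - 1.
  have [->|h] := eqVneq (y / A) 1; first by rewrite ln1 subrr.
  by apply/ltW/ln_lt_subr1 => //; rewrite divr_gt0.
have e2 : ln (A^-1) < A^-1 - 1.
  by apply: ln_lt_subr1; rewrite ?invr_gt0// invr_eq1.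
have hA : (y / A - 1) + (m - 1) * (A^-1 - 1) = 0.
  have mA0 : m - 1 + y != 0 by rewrite gt_eqF//; lra.
  rewrite AE; field; by rewrite (gt_eqF m0)/= addrA addrAC.
move: e1 e2; rewrite ln_div ?posrE// lnV ?posrE// lny => e1 e2.
have : ln t < ln A.
  have : (m - 1) * - ln A < (m - 1) * (A^-1 - 1) by rewrite ltr_pM2l//; lra.
  rewrite mulrN => h; rewrite -(ltr_pM2l m0).
  have : (m - 1) * ln A = m * ln A - ln A by ring.
  by move: (y / A) ((m - 1) * _) ((m - 1) * _) (m * ln A) (m * ln t) e1 hA h
    => ? ? ? ? ?; lra.
rewrite ltr_ln ?posrE// => tA.
have : m * t < m * A by rewrite ltr_pM2l.
have -> : m * A = m + y - 1 by rewrite AE; field; rewrite gt_eqF.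
by lra.
Qed.

Lemma powR_gt_tangent m r s : 1 < m -> 0 < r -> 0 <= s -> s != r ->
  r `^ m + m * r `^ (m - 1) * (s - r) < s `^ m.
Proof.
move=> m1 r0 s0 sr; have m0 : 0 < m by apply: lt_trans m1.
have t1 : s / r != 1.
  by apply: contra sr => /eqP h; rewrite -(divfK (lt0r_neq0 r0) s) h mul1r.
have := powR_bernoulli m1 (divr_ge0 s0 (ltW r0)) t1.
have rm : 0 < r `^ m by exact: powR_gt0.
rewrite -(ltr_pM2r rm) -powRM ?divr_ge0 ?(ltW r0)// divfK ?gt_eqF//.
apply: le_lt_trans; rewrite -(mulr_powRB1 (ltW r0) m0).
rewrite le_eqVlt; apply/orP; left; apply/eqP.
by field; rewrite gt_eqF.
Qed.

(** The point s >= 0 at which a * s ^ m - u * s is smallest: it solves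
    a * m * s ^ (m - 1) = u when u >= 0, and it is 0 when u <= 0. *)
Definition best_density m a u := (Num.max 0 (u / (a * m))) `^ (m - 1)^-1.

Lemma best_density_ge0 m a u : 0 <= best_density m a u.
Proof. exact: powR_ge0. Qed.

(** Minimality is strict, so that a density which does as well as the pointwise
    minimiser after integration must agree with it almost everywhere. *)
Lemma best_density_min m a u s : 1 < m -> 0 < a -> 0 <= s ->
  s != best_density m a u ->
  a * best_density m a u `^ m - u * best_density m a u < a * s `^ m - u * s.
Proof.
move=> m1 a0 s0; have m0 : 0 < m by apply: lt_trans m1.
have am0 : 0 < a * m by rewrite mulr_gt0.
have p0 : (m - 1)^-1 != 0 by rewrite invr_neq0// subr_eq0 gt_eqF.
rewrite /best_density; case: (leP u 0) => [u0|u0].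
  rewrite max_l ?ler_pdivrMr ?mul0r// powR0// => sn0.
  have {sn0}s0 : 0 < s by rewrite lt_neqAle eq_sym sn0.
  rewrite powR0 ?gt_eqF// !mulr0 subr0 subr_gt0.
  apply: (@le_lt_trans _ _ 0); last by rewrite mulr_gt0 ?powR_gt0.
  by rewrite mulr_le0_ge0// ltW.
rewrite max_r ?divr_ge0 ?(ltW u0) ?(ltW am0)//.
have q0 : 0 < u / (a * m) by rewrite divr_gt0.
have uE : u = a * m * ((u / (a * m)) `^ (m - 1)^-1) `^ (m - 1).
  rewrite -powRrM mulVf ?subr_eq0 ?gt_eqF// powRr1 ?ltW//.
  by rewrite mulrC divfK ?gt_eqF.
move: (_ `^ (m - 1)^-1) uE (powR_gt0 (m - 1)^-1 q0) => r uE r0 sr.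
have := powR_gt_tangent m1 r0 s0 sr; rewrite -(ltr_pM2l a0) uE.
by lra.
Qed.

Lemma le_best_density m a u v : 1 < m -> 0 < a -> u <= v ->
  best_density m a u <= best_density m a v.
Proof.
move=> m1 a0 uv; have m0 : 0 < m by apply: lt_trans m1.
have am0 : 0 < a * m by rewrite mulr_gt0.
apply: ge0_ler_powR; rewrite ?nnegrE.
- by rewrite invr_ge0 subr_ge0 ltW.
- by rewrite le_max lexx.
- by rewrite le_max lexx.
rewrite ge_max !le_max lexx/=.
by rewrite (ler_pM2r (_ : 0 < (a * m)^-1)) ?invr_gt0// uv orbT.
Qed.

Lemma best_densityK m a r : 1 < m -> 0 < a -> 0 <= r ->
  best_density m a (a * m * r `^ (m - 1)) = r.
Proof.
move=> m1 a0 r0; have m0 : 0 < m by apply: lt_trans m1.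
rewrite /best_density mulrAC mulfV ?mul1r ?gt_eqF ?mulr_gt0//.
rewrite max_r ?powR_ge0// -powRrM mulfV ?powRr1//.
by rewrite subr_eq0 gt_eqF.
Qed.

Lemma continuous_powR_max p : 0 < p ->
  continuous (fun t : R => Num.max 0 t `^ p).
Proof.
move=> p0 x; have [x0|x0|->] := ltgtP x 0.
- have : \forall t \near x, 0 = Num.max 0 t `^ p.
    near=> t; rewrite max_l ?powR0 ?gt_eqF//.
    by near: t; exact: lt_le_nbhsl.
  rewrite /continuous_at max_l ?ltW// powR0 ?gt_eqF// => /near_eq_cvg h.
  by apply: cvg_trans h _; exact: cvg_cst.
- rewrite /continuous_at.
  have : \forall t \near x, expR (p * ln t) = Num.max 0 t `^ p.
    near=> t; have t0 : 0 < t by near: t; exact: lt_nbhsr.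
    by rewrite max_r ?ltW// /powR gt_eqF.
  have -> : Num.max 0 x `^ p = expR (p * ln x).
    by rewrite max_r ?ltW// /powR gt_eqF.
  move=> /near_eq_cvg h.
  apply: cvg_trans h _; apply: continuous_cvg; first exact: continuous_expR.
  by apply: cvgM; [exact: cvg_cst|exact: continuous_ln].
- rewrite /continuous_at maxxx powR0 ?gt_eqF//.
  apply/cvgrPdist_le => /= e e0.
  have d0 : 0 < e `^ p^-1 by exact: powR_gt0.
  near=> t.
  rewrite sub0r normrN ger0_norm ?powR_ge0//.
  have : Num.max 0 t <= e `^ p^-1.
    rewrite ge_max (ltW d0)/=; near: t.
    exact: (lt_le_nbhsl d0).
  move=> /(ge0_ler_powR (ltW p0)); rewrite !nnegrE le_max lexx powR_ge0.
  move=> /(_ isT isT) /le_trans; apply.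
  by rewrite -powRrM mulVf ?gt_eqF// powRr1// ltW.
Unshelve. all: by end_near. Qed.

End real_power.

(** * Sequences and limits superior *)

Lemma invSn_lt (R : realType) (e : R) : 0 < e -> exists n, (n.+1%:R)^-1 < e.
Proof.
move=> e0; exists (Num.truncn e^-1); rewrite invf_plt ?posrE//.
exact: truncnS_gt.
Qed.

Lemma cvg_invSn_bound (R : realType) (u : nat -> R) (l : R) :
  (forall n, `|u n - l| <= (n.+1%:R)^-1) -> u @ \oo --> l.
Proof.
move=> ul; apply/cvgrPdist_le => /= e e0; have [N Ne] := invSn_lt e0.
exists N => // n /= Nn; rewrite distrC (le_trans (ul n))//.
rewrite (le_trans _ (ltW Ne))//.
by rewrite lef_pV2 ?posrE// ler_nat ltnS.
Qed.

Lemma limf_esup_neq0 (R : realType) (T : choiceType) (X : filteredType T)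
    (f : X -> \bar R) (F : set_system X) : ProperFilter F ->
  (forall x, 0 <= f x)%E -> limf_esup f F <> 0%E ->
  exists2 e : R, 0 < e & forall P, F P -> exists2 x, P x & (e%:E < f x)%E.
Proof.
move=> FF f0 fn0.
have f_ge0 : (0 <= limf_esup f F)%E.
  by apply: limf_esup_ge0 => //; exact: filter_not_empty.
have fgt0 : (0 < limf_esup f F)%E.
  by rewrite lt_neqAle f_ge0 andbT eq_sym; exact/eqP.
have [e e0 ef] : exists2 e : R, 0 < e & (e%:E < limf_esup f F)%E.
  move: fgt0; case: (limf_esup f F) => [r| |]//.
    by rewrite lte_fin => r0; exists (r / 2); rewrite ?lte_fin//; lra.
  by move=> _; exists 1 => //; exact: ltry.
exists e => // P FP.
have : (e%:E < ereal_sup (f @` P))%E.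
  by apply: lt_le_trans ef _; apply: ereal_inf_lbound; exists P.
by move=> /ereal_sup_gt[_ [x Px <-] ex]; exists x.
Qed.

(** * Equicontinuous families on a compact set *)

Section ascoli.
Context {R : realType}.

Lemma ultrafilter_bounded_cvg (I : Type) (G : set_system I) (v : I -> R)
    (B : R) :
  UltraFilter G -> (forall i, `|v i| <= B) -> exists p : R, v @ G --> p.
Proof.
move=> GU vB; have GF : ProperFilter G by exact: ultra_proper.
have vI : G (v @^-1` `[- B, B]%classic).
  by apply: filterE => i /=; rewrite in_itv/= -ler_norml; exact: vB.
have [p [_ pcl]] := @segment_compact _ (- B) B (v @ G) _ vI.
exists p => V pV; have [//|GVC] := in_ultra_setVsetC (v @^-1` V) GU.
have [y [/= yVC yV]] := pcl (~` V) V GVC pV.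
by have := yVC yV.
Qed.

(** A form of the Arzela-Ascoli theorem.  Along an ultrafilter finer than F the
    bounded families u i x converge for each x; equicontinuity turns this into
    locally uniform convergence, and compactness of A into uniform convergence
    on A.  Composition with h is built in because the densities of minimisers
    are nonlinear functions of potentials, and only the potentials are
    equicontinuous by direct estimates. *)
Lemma equicontinuous_cluster (T : topologicalType) (A : set T) (I : Type)
    (F : set_system I) (u : I -> T -> R) (h : R -> R) (B : R) :
  ProperFilter F -> compact A -> continuous h -> (forall i x, `|u i x| <= B) ->
  (forall x (e : R), 0 < e ->
    \forall x' \near x, forall i, `|u i x - u i x'| <= e) ->
  exists w : T -> R, forall (e : R) P, 0 < e -> F P ->
    exists2 i, P i & forall x, A x -> `|h (u i x) - h (w x)| <= e.
Proof.
move=> PF cA ch uB equi.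
have [G [GU FG]] := ultraFilterLemma PF.
have GF : ProperFilter G by exact: ultra_proper.
have /choice[w uw] : forall x, exists p : R, u ^~ x @ G --> p.
  by move=> x; exact: ultrafilter_bounded_cvg GU (uB^~ x).
have wequi x (e : R) : 0 < e -> \forall x' \near x, `|w x - w x'| <= e.
  move=> e0; near=> x'.
  have : (fun i => `|u i x - u i x'|) @ G --> `|w x - w x'|.
    by apply: cvg_norm; apply: cvgB; exact: uw.
  move=> /cvgr_to_le; apply; apply: nearW => i.
  by move: i; near: x'; exact: equi.
exists w => e P e0 FP.
have := (compact_near_coveringP A).1 cA I G
  (fun i x => `|h (u i x) - h (w x)| <= e).
have loc x : A x -> \forall x' \near x & i \near G,
    `|h (u i x') - h (w x')| <= e.
  move=> _; have e20 : 0 < e / 2 by rewrite divr_gt0.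
  have /cvgrPdist_le/(_ _ e20)[/= d d0 hd] := ch (w x).
  have d20 : 0 < d / 2 by rewrite divr_gt0.
  have d40 : 0 < d / 4 by rewrite divr_gt0.
  exists ([set x' | (forall i, `|u i x - u i x'| <= d / 4) /\
    `|w x - w x'| <= d / 2], [set i | `|w x - u i x| <= d / 4]).
    split; last by move/cvgrPdist_le : (uw x); exact.
    by apply: filterI; [exact: equi|exact: wequi].
  move=> [x' i] /= [[/(_ i) h1 h3] h2].
  have l1 : `|w x - u i x'| < d.
    rewrite (le_lt_trans (ler_distD (u i x) _ _))//.
    by rewrite (le_lt_trans (lerD h2 h1))//; lra.
  have l2 : `|w x - w x'| < d by rewrite (le_lt_trans h3)//; lra.
  have := hd _ l1; have := hd _ l2 => /= k2 k1.
  rewrite (le_trans (ler_distD (h (w x)) _ _))// (splitr e) distrC.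
  by rewrite lerD.
move=> /(_ _ loc) near_u.
have : G (P `&` (fun i => A `<=` (fun x => `|h (u i x) - h (w x)| <= e))).
  by apply: filterI => //; exact: FG.
by move=> /filter_ex[i [Pi ui]]; exists i.
Unshelve. all: by end_near. Qed.

End ascoli.

(** * Integrals of bounded functions and interaction energies *)

Section bounded_functions.
Context d {T : measurableType d} {R : realType}.
Variable mu : {finite_measure set T -> \bar R}.
Implicit Types f g : T -> R.

Lemma bounded_integrable f (M : R) : measurable_fun setT f ->
  (forall x, `|f x| <= M) -> mu.-integrable setT (EFin \o f).
Proof.
move=> mf fM; apply: measurable_bounded_integrable => //.
  by rewrite -ge0_fin_numE// fin_num_measure.
exists M; split; first exact: num_real.
by move=> N MN x _; exact: le_trans (fM x) (ltW MN).
Qed.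

Lemma bounded_integrableM f g (M : R) : measurable_fun setT f ->
  (forall x, `|f x| <= M) -> mu.-integrable setT (EFin \o g) ->
  mu.-integrable setT (EFin \o (fun x => f x * g x)).
Proof.
move=> mf fM ig; apply: (@eq_integrable _ _ _ _ _ measurableT
  ((EFin \o f) \* (EFin \o g))%E) => [//|].
apply: integrableMr => //; exists M; split; first exact: num_real.
by move=> N MN x _; exact: le_trans (fM x) (ltW MN).
Qed.

Lemma bounded_convergence (f_ : nat -> T -> R) f (M : R) :
  (forall n, measurable_fun setT (f_ n)) -> measurable_fun setT f ->
  (forall n x, `|f_ n x| <= M) -> (forall x, f_ ^~ x @ \oo --> f x) ->
  (\int[mu]_x f_ n x) @[n --> \oo] --> \int[mu]_x f x.
Proof.
move=> mf_ mf fM ff.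
have fM' x : `|f x| <= M.
  have h : `|f_ n x| @[n --> \oo] --> `|f x| by apply: cvg_norm; exact: ff.
  rewrite -(cvg_lim (@norm_hausdorff _ _) h)//.
  apply: limr_le; first by apply/cvg_ex; eexists; exact: h.
  by apply: nearW => n; exact: fM.
have fi := bounded_integrable mf fM'.
apply: fine_cvg; rewrite /Rintegral fineK; last exact: integrable_fin_num.
apply: (@dominated_cvg _ _ _ mu setT measurableT
  (fun n => EFin \o f_ n) (EFin \o f) (cst M%:E)) => //.
- by move=> n; exact/measurable_EFinP.
- by move=> x _; apply: cvg_EFin; [exact: nearW|exact: ff].
- apply: (@bounded_integrable (cst M) `|M|) => //.
- by move=> n x _; rewrite lee_fin; exact: fM.
Qed.

(** The bound on k is only asked where f is nonzero: this is how estimates that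
    hold on the cell of the torus are integrated. *)
Lemma average_bound (k f : T -> R) (N M : R) : measurable_fun setT k ->
  (forall x, `|k x| <= N) -> (forall x, 0 <= f x) ->
  mu.-integrable setT (EFin \o f) -> \int[mu]_x f x = 1 ->
  (forall x, `|k x| * f x <= M * f x) -> `|\int[mu]_x (k x * f x)| <= M.
Proof.
move=> mk kN f0 fi f1 kM; have kfi := bounded_integrableM mk kN fi.
rewrite (le_trans (le_normr_Rintegral _ _))//.
rewrite -[leRHS]mulr1 -f1 -RintegralZl//.
apply: le_Rintegral => //.
- exact: integrable_norm.
- by have := integrableZl measurableT M fi; apply: eq_integrable.
- by move=> x _; rewrite normrM (ger0_norm (f0 x)).
Qed.

Lemma Rintegral_eq0_ae f : mu.-integrable setT (EFin \o f) ->
  (forall x, 0 <= f x) -> \int[mu]_x f x <= 0 -> {ae mu, forall x, f x = 0}.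
Proof.
move=> fi f0 If.
have {}If : \int[mu]_x f x = 0 by apply/eqP; rewrite eq_le If Rintegral_ge0.
have mf := measurable_int _ fi.
have : (\int[mu]_x `|(f x)%:E| = 0)%E.
  under eq_integral do rewrite gee0_abs ?lee_fin//.
  rewrite -[LHS]fineK ?(integrable_fin_num measurableT fi)//.
  by rewrite -/(Rintegral _ _ _) If.
move/(ae_eq_integral_abs mu measurableT mf).
by apply: filterS => x /= /(_ I)[].
Qed.

End bounded_functions.

Section interaction.
Context d {T : measurableType d} {R : realType}.
Variable mu : {finite_measure set T -> \bar R}.
Variables (K : T * T -> R) (M : R).
Hypothesis mK : measurable_fun setT K.
Hypothesis KM : forall z, `|K z| <= M.
Implicit Types f g h : T -> R.

Local Notation intg f := (mu.-integrable setT (EFin \o f)).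

Definition interaction f g : R :=
  \int[(mu \x mu)%E]_z (K z * f z.1 * g z.2).

Definition potential g x : R := \int[mu]_y (K (x, y) * g y).

Let M0 : 0 <= M.
Proof. exact: le_trans (normr_ge0 _) (KM (point, point)). Qed.

Let measurableK2 x : measurable_fun setT (fun y => K (x, y)).
Proof. by apply: measurableT_comp => //; exact: measurable_pair1. Qed.

Lemma integrable_section g x : intg g -> intg (fun y => K (x, y) * g y).
Proof.
by move=> ig; apply: (@bounded_integrableM _ _ _ mu _ _ M) => // y; exact: KM.
Qed.

Let measurable_interaction f g : intg f -> intg g ->
  measurable_fun setT (fun z : T * T => K z * f z.1 * g z.2).
Proof.
move=> /(measurable_int _)/measurable_EFinP mf.
move=> /(measurable_int _)/measurable_EFinP mg.
apply: measurable_funM; last by apply: measurableT_comp => //.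
by apply: measurable_funM => //; apply: measurableT_comp => //.
Qed.

Lemma integrable_interaction f g : intg f -> intg g ->
  (mu \x mu)%E.-integrable setT
    (EFin \o (fun z => K z * f z.1 * g z.2)).
Proof.
move=> fi gi; have mfg := measurable_interaction fi gi.
apply/integrable12ltyP; first exact/measurable_EFinP.
have nf : intg (fun x => `|f x|) by exact: integrable_norm.
have ng : intg (fun x => `|g x|) by exact: integrable_norm.
have := ng => /(integrable_fin_num measurableT)/fineK.
rewrite -/(Rintegral mu setT (fun x => `|g x|)) => Ig.
apply: (@le_lt_trans _ _
  (\int[mu]_x (M * (\int[mu]_y `|g y|) * `|f x|)%:E)%E).
  apply: ge0_le_integral => //.
  - by move=> x _; exact: integral_ge0.
  - apply: (measurable_fun_fubini_tonelli_F
      (fun z : T * T => `|(K z * f z.1 * g z.2)%:E|)%E) => //.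
    by apply: measurableT_comp => //; exact/measurable_EFinP.
  - apply/measurable_EFinP; apply: measurable_funM => //.
    by have /measurable_int/measurable_EFinP := nf.
  - move=> x _; apply: (@le_trans _ _
      (\int[mu]_y ((M * `|f x|)%:E * `|g y|%:E))%E).
      apply: ge0_le_integral => //.
      + apply: measurableT_comp => //; apply/measurable_EFinP.
        exact: (measurableT_comp mfg (measurable_pair1 x)).
      + by apply: measurable_funeM; have /measurable_int := ng.
      + move=> y _; rewrite -EFinM lee_fin !normrM.
        by rewrite ler_wpM2r// ler_wpM2r.
    rewrite ge0_integralZl//=; last 2 first.
    + by have /measurable_int := ng.
    + by rewrite lee_fin mulr_ge0.
    by rewrite -Ig -EFinM lee_fin mulrAC.
have := @integrableZl _ _ _ mu setT measurableT (M * (\int[mu]_y `|g y|)) _ nf.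
move=> /integrableP[_]; apply: le_lt_trans; apply: ge0_le_integral => //.
- by move=> x _; rewrite lee_fin !mulr_ge0// Rintegral_ge0.
- apply/measurable_EFinP; apply: measurable_funM => //.
  by have /measurable_int/measurable_EFinP := nf.
- apply: measurableT_comp => //; apply: measurable_funeM.
  by have /measurable_int := nf.
- by move=> x _; rewrite -EFinM; exact: lee_abs.
Qed.

(** The inner integral of Fubini's theorem, which is finite at every x and not
    just almost everywhere because K is bounded. *)
Lemma fubini_interaction f g x : intg f -> intg g ->
  (\int[mu]_y (K (x, y) * f x * g y)%:E = (f x * potential g x)%:E)%E.
Proof.
move=> fi gi; have Kgi := integrable_section x gi.
under eq_integral do rewrite mulrAC mulrC EFinM.
by rewrite integralZl// EFinM /potential fineK//; exact: integrable_fin_num.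
Qed.

Lemma integrable_potential f g : intg f -> intg g ->
  intg (fun x => f x * potential g x).
Proof.
move=> fi gi; have := integrable_fubini_F (integrable_interaction fi gi).
by apply: eq_integrable => // x _; rewrite /fubini_F/= fubini_interaction.
Qed.

Lemma interaction_potential f g : intg f -> intg g ->
  interaction f g = \int[mu]_x (f x * potential g x).
Proof.
move=> fi gi; rewrite /interaction {1}/Rintegral.
rewrite -integral12_prod_meas1; last exact: integrable_interaction.
congr fine; apply: eq_integral => x _.
by rewrite /fubini_F/= fubini_interaction.
Qed.

Lemma measurable_potential g : intg g -> measurable_fun setT (potential g).
Proof.
move=> gi; have i1 : intg (cst 1).
  by apply: (@bounded_integrable _ _ _ _ _ 1) => // x; rewrite normr1.
have /measurable_int/measurable_EFinP := integrable_potential i1 gi.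
by apply: eq_measurable_fun => x _; rewrite mul1r.
Qed.

Hypothesis Ksym : forall x y, K (x, y) = K (y, x).

Lemma interactionC f g : intg f -> intg g -> interaction f g = interaction g f.
Proof.
move=> fi gi; rewrite interaction_potential// /interaction /Rintegral.
rewrite -integral21_prod_meas1; last exact: integrable_interaction.
congr fine; apply: eq_integral => x _; rewrite /fubini_G/=.
rewrite -fubini_interaction//; apply: eq_integral => y _.
by rewrite Ksym mulrAC.
Qed.

End interaction.

(** * Minimisers of the energy and their Euler-Lagrange equation *)

Section convexity.
Context {R : realType}.
Implicit Types m s r t : R.

(** Both endpoints lie above the tangent at the intermediate point. *)
Lemma powR_convex m s r t : 1 < m -> 0 <= s -> 0 <= r -> 0 <= t <= 1 ->
  ((1 - t) * s + t * r) `^ m <= (1 - t) * s `^ m + t * r `^ m.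
Proof.
move=> m1 s0 r0 /andP[t0 t1]; have m0 : 0 < m by apply: lt_trans m1.
have t1' : 0 <= 1 - t by rewrite subr_ge0.
have z0 : 0 <= (1 - t) * s + t * r by rewrite addr_ge0// mulr_ge0.
have [ze|zn] := eqVneq ((1 - t) * s + t * r) 0.
  rewrite ze powR0 ?gt_eqF//.
  by rewrite addr_ge0// mulr_ge0// powR_ge0.
have {zn}z0 : 0 < (1 - t) * s + t * r by rewrite lt_neqAle eq_sym zn.
set z := (1 - t) * s + t * r in z0 *.
have tangent x : 0 <= x -> z `^ m + m * z `^ (m - 1) * (x - z) <= x `^ m.
  move=> x0; have [->|xz] := eqVneq x z; first by rewrite subrr mulr0 addr0.
  exact/ltW/powR_gt_tangent.
have hs := ler_wpM2l t1' (tangent s s0).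
have hr := ler_wpM2l t0 (tangent r r0).
apply: le_trans (lerD hs hr); rewrite le_eqVlt; apply/orP; left; apply/eqP.
by rewrite /z; ring.
Qed.

Lemma affine_ge0 (A B : R) :
  (forall t, 0 < t <= 1 -> 0 <= A + t * B) -> 0 <= A.
Proof.
move=> h; rewrite leNgt; apply/negP => A0.
have B0 : 0 < B.
  by have := h 1; rewrite ltr01 lexx mul1r => /(_ isT); lra.
pose t := Num.min 1 (- A / (2 * B)).
have t01 : 0 < t <= 1.
  by rewrite lt_min ltr01/= ge_min lexx andbT divr_gt0// ?oppr_gt0// mulr_gt0.
have := h t t01; apply/negP; rewrite -ltNge.
have : t * B <= - A / 2.
  have -> : - A / 2 = - A / (2 * B) * B by field; rewrite gt_eqF.
  by rewrite ler_pM2r// ge_min lexx orbT.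
by lra.
Qed.

End convexity.

Section prescribed_mass.
Context d {T : measurableType d} {R : realType}.
Variable mu : {finite_measure set T -> \bar R}.
Variables (m a : R) (v : T -> R) (M : R).
Hypotheses (m1 : 1 < m) (a0 : 0 < a).
Hypotheses (mv : measurable_fun setT v) (vM : forall x, `|v x| <= M).
Hypothesis mu0 : (0 < mu setT)%E.

Let c := (fine (mu setT))^-1.

Lemma continuous_best_density : continuous (best_density m a).
Proof.
have p0 : 0 < (m - 1)^-1 by rewrite invr_gt0 subr_gt0.
move=> u; apply: (@cvg_comp _ _ _ (fun u : R => u / (a * m))
  (fun t => Num.max 0 t `^ (m - 1)^-1) _ (nbhs (u / (a * m)))).
  by apply: cvgM; [exact: cvg_id|exact: cvg_cst].
exact: continuous_powR_max.
Qed.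

Lemma measurable_best_density (u : T -> R) : measurable_fun setT u ->
  measurable_fun setT (fun x => best_density m a (u x)).
Proof.
move=> mu'; apply: (measurableT_comp _ mu').
apply: continuous_measurable_fun; exact: continuous_best_density.
Qed.

(** The mass of best_density m a (C - v) is continuous in C.  Since v lies between
    - M and M, the density is at most the uniform one for C = h - M and at least
    the uniform one for C = h + M, where h is the level whose best density is
    the uniform one; the intermediate value theorem applies in between. *)
Lemma best_density_mass : exists2 C,
  `|C - a * m * c `^ (m - 1)| <= M &
  \int[mu]_x best_density m a (C - v x) = 1.
Proof.
have V0 : 0 < fine (mu setT).
  by rewrite fine_gt0// mu0/= -ge0_fin_numE// fin_num_measure.
have c0 : 0 < c by rewrite invr_gt0.
have M0 : 0 <= M by exact: le_trans (normr_ge0 _) (vM point).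
set h := a * m * c `^ (m - 1).
have bh : best_density m a h = c by rewrite best_densityK// ltW.
have mf C : measurable_fun setT (fun x => best_density m a (C - v x)).
  by apply: measurable_best_density; exact: measurable_funB.
have bnd C N : C <= N ->
    forall x, `|best_density m a (C - v x)| <= best_density m a (N + M).
  move=> CN x; rewrite ger0_norm ?best_density_ge0// le_best_density//.
  by rewrite lerD// lerNl; have := vM x; rewrite ler_norml => /andP[].
have fi C := bounded_integrable mu (mf C) (bnd C C (lexx C)).
have i_c : mu.-integrable setT (EFin \o cst c).
  by apply: (@bounded_integrable _ _ _ _ _ `|c|).
have cV : \int[mu]_x c = 1 by rewrite Rintegral_cst// mulVf// gt_eqF.
pose F C := \int[mu]_x best_density m a (C - v x).
have Fc : {within `[h - M, h + M], continuous F}.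
  apply: continuous_subspaceT => C.
  apply: (@continuity_under_integral _ _ _ mu
    (fun C x => best_density m a (C - v x)) setT measurableT (C - 1) (C + 1)
    _ _ (cst (best_density m a (C + 1 + M)))).
  - by move=> *; exact: fi.
  - apply: aeW => x _ C' _.
    apply: (@cvg_comp _ _ _ (fun C => C - v x) (best_density m a) _
      (nbhs (C' - v x))).
      by apply: cvgB; [exact: cvg_id|exact: cvg_cst].
    exact: continuous_best_density.
  - by apply: (@bounded_integrable _ _ _ _ _ `|best_density m a (C + 1 + M)|).
  - move=> C'; rewrite /= in_itv/= => /andP[_ C'C].
    by apply: aeW => x _; apply: bnd; exact: ltW.
  - by rewrite inE/= in_itv/= gtrBl ltr01 ltrDl ltr01.
have hM : h - M <= h + M by lra.
have [|C] := @IVT _ F (h - M) (h + M) 1 hM Fc.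
- rewrite ge_min le_max; apply/andP; split; apply/orP.
    left; rewrite -cV; apply: le_Rintegral => // x _; rewrite -[leRHS]bh.
    by apply: le_best_density => //; have := vM x; rewrite ler_norml; lra.
  right; rewrite -cV; apply: le_Rintegral => // x _; rewrite -[leLHS]bh.
  by apply: le_best_density => //; have := vM x; rewrite ler_norml; lra.
rewrite in_itv/= => ChM FC; exists C => //.
by rewrite ler_norml; lra.
Qed.

End prescribed_mass.

Section minimisers.
Context d {T : measurableType d} {R : realType}.
Variable mu : {finite_measure set T -> \bar R}.
Variables (K : T * T -> R) (M : R).
Hypothesis mK : measurable_fun setT K.
Hypothesis KM : forall z, `|K z| <= M.
Hypothesis Ksym : forall x y, K (x, y) = K (y, x).
Variables (m a : R).
Hypotheses (m1 : 1 < m) (a0 : 0 < a).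
Implicit Types f g h : T -> R.

Local Notation intg f := (mu.-integrable setT (EFin \o f)).
Local Notation pot := (potential mu K).
Local Notation inter := (interaction mu K).

(** Probability densities with integrable m-th power: those of finite energy. *)
Definition admissible f := [/\ measurable_fun setT f, forall x, 0 <= f x,
  intg f, \int[mu]_x f x = 1 & intg (fun x => f x `^ m)].

Definition energy f : R :=
  a * (\int[mu]_x (f x `^ m)) + 2^-1 * inter f f.

Definition energy_minimiser f := admissible f /\
  forall g, admissible g -> energy f <= energy g.

Lemma measurable_funpowR f p : measurable_fun setT f ->
  measurable_fun setT (fun x => f x `^ p).
Proof. by move=> mf; apply: (measurableT_comp (measurable_powR _) mf). Qed.

Lemma bounded_admissible f (B : R) : measurable_fun setT f ->
  (forall x, 0 <= f x <= B) -> \int[mu]_x f x = 1 -> admissible f.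
Proof.
move=> mf fB f1; have f0 x : 0 <= f x by have /andP[] := fB x.
split => //.
  apply: (@bounded_integrable _ _ _ mu _ B) => // x.
  by rewrite ger0_norm//; have /andP[] := fB x.
apply: (@bounded_integrable _ _ _ mu _ (B `^ m)).
  exact: measurable_funpowR.
move=> x; rewrite ger0_norm ?powR_ge0//; have /andP[fx0 fxB] := fB x.
apply: ge0_ler_powR; rewrite ?nnegrE//; first by rewrite ltW// (lt_trans _ m1).
exact: le_trans fxB.
Qed.

Lemma potential_bound f x : admissible f -> `|pot f x| <= M.
Proof.
move=> [mf f0 fi f1 _]; apply: (@average_bound _ _ _ _ _ _ M) => //.
- by apply: measurableT_comp => //; exact: measurable_pair1.
- by move=> y; rewrite ler_wpM2r.
Qed.

Local Notation mix t f g := (fun x => (1 - t) * f x + t * g x).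

Lemma integrable_lincomb (s t : R) f g : intg f -> intg g ->
  intg (fun x => s * f x + t * g x).
Proof.
move=> fi gi.
have := integrableD measurableT (integrableZl measurableT s fi)
  (integrableZl measurableT t gi).
by apply: eq_integrable.
Qed.

Lemma Rintegral_lincomb (s t : R) f g : intg f -> intg g ->
  \int[mu]_x (s * f x + t * g x) = s * \int[mu]_x f x + t * \int[mu]_x g x.
Proof.
move=> fi gi; rewrite RintegralD//.
- by rewrite !RintegralZl.
- by have := integrableZl measurableT s fi; apply: eq_integrable.
- by have := integrableZl measurableT t gi; apply: eq_integrable.
Qed.

Lemma admissible_mix t f g : 0 <= t <= 1 -> admissible f -> admissible g ->
  admissible (mix t f g).
Proof.
move=> t01 [mf f0 fi f1 fm] [mg g0 gi g1 gm]; have /andP[t0 t1] := t01.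
have mfg : measurable_fun setT (mix t f g).
  by apply: measurable_funD; exact: measurable_funM.
split => //.
- by move=> x; rewrite addr_ge0// mulr_ge0// subr_ge0.
- exact: integrable_lincomb.
- by rewrite Rintegral_lincomb// f1 g1 !mulr1 subrK.
- apply: le_integrable (integrable_lincomb (1 - t) t fm gm) => //.
    exact/measurable_EFinP/measurable_funpowR.
  move=> x _ /=; rewrite lee_fin ger0_norm ?powR_ge0//.
  by apply: le_trans (ler_norm _); exact: powR_convex.
Qed.

Lemma interaction_mix t f g : intg f -> intg g ->
  inter (mix t f g) (mix t f g) = (1 - t) ^+ 2 * inter f f +
    2 * (t * (1 - t)) * inter f g + t ^+ 2 * inter g g.
Proof.
move=> fi gi; have tfg := integrable_lincomb (1 - t) t fi gi.
have expand u : intg u ->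
    inter (mix t f g) u = (1 - t) * inter f u + t * inter g u.
  move=> ui; rewrite !(interaction_potential mK KM)//.
  rewrite -Rintegral_lincomb; [|exact: (integrable_potential mK KM)..].
  by apply: eq_Rintegral => x _; ring.
rewrite expand// ![inter _ (mix t f g)](interactionC mK KM Ksym)//.
rewrite !expand// (interactionC mK KM Ksym gi fi).
by ring.
Qed.

(** First variation without differentiating the power: along (1 - t) f + t g the
    entropy is below its chord by convexity, and the quadratic interaction
    departs from its linearisation at f by a multiple of t ^ 2.  Minimality of f
    divided by t, with t going to 0, gives the claim, even for unbounded f. *)
Lemma linearised_minimality f g : energy_minimiser f -> admissible g ->
  a * (\int[mu]_x (f x `^ m)) + \int[mu]_x (f x * pot f x) <=
  a * (\int[mu]_x (g x `^ m)) + \int[mu]_x (g x * pot f x).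
Proof.
move=> [fa fmin] ga; have [mf f0 fi f1 fm] := fa; have [mg g0 gi g1 gm] := ga.
rewrite -!(interaction_potential mK KM)// -subr_ge0.
apply: (@affine_ge0 _ _ (2^-1 * (inter f f - 2 * inter f g + inter g g))).
move=> t /andP[t0 t1].
have t01 : 0 <= t <= 1 by rewrite (ltW t0).
have fga := admissible_mix t01 fa ga.
have := fmin _ fga; rewrite /energy interaction_mix//.
have : \int[mu]_x (mix t f g x `^ m) <=
    (1 - t) * (\int[mu]_x (f x `^ m)) + t * \int[mu]_x (g x `^ m).
  rewrite -Rintegral_lincomb//; apply: le_Rintegral => //.
  - by have [] := fga.
  - exact: integrable_lincomb.
  - by move=> x _; exact: powR_convex.
move=> /(ler_wpM2l (ltW a0)) h1 h2.
rewrite (interactionC mK KM Ksym gi fi) -(pmulr_rge0 _ t0).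
set P := \int[mu]_x (f x `^ m) in h1 h2 *.
set Q := \int[mu]_x (g x `^ m) in h1 h2 *.
have := le_trans h2 (lerD h1 (lexx _)); rewrite -subr_ge0.
move/le_trans; apply; rewrite le_eqVlt; apply/orP; left; apply/eqP.
by field.
Qed.

Hypothesis mu0 : (0 < mu setT)%E.

(** Let s be the density of mass 1 given by best_density at the level C - pot f.
    Pointwise s strictly minimises s |-> a s ^ m + (pot f - C) s, while f
    minimises the integral of this expression among admissible densities, the
    term in C being constant there.  Hence f and s have the same integral and
    agree almost everywhere. *)
Theorem euler_lagrange f : energy_minimiser f -> exists2 C,
  `|C - a * m * (fine (mu setT))^-1 `^ (m - 1)| <= M &
  {ae mu, forall x, f x = best_density m a (C - pot f x)}.
Proof.
move=> fmin; have [fa _] := fmin; have [mf f0 fi f1 fm] := fa.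
have mV := measurable_potential mK KM fi.
have VM x := potential_bound x fa.
have [C CM C1] := best_density_mass m1 a0 mV VM mu0.
exists C => //.
set s := fun x => best_density m a (C - pot f x).
have ms : measurable_fun setT s.
  by apply: measurable_best_density => //; exact: measurable_funB.
have M0 : 0 <= M by exact: le_trans (normr_ge0 _) (VM point).
have sB x : 0 <= s x <= best_density m a (C + M).
  rewrite best_density_ge0 le_best_density// lerD// lerNl.
  by have := VM x; rewrite ler_norml => /andP[].
have sa := bounded_admissible ms sB C1.
have [_ s0 si s1 sm] := sa.
pose G (h : T -> R) x := a * h x `^ m + (h x * pot f x - C * h x).
have Gi h : admissible h -> intg (G h) /\
    \int[mu]_x G h x = a * (\int[mu]_x (h x `^ m)) +
      \int[mu]_x (h x * pot f x) - C.
  move=> [mh h0 hi h1 hm]; have hV := integrable_potential mK KM hi fi.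
  have hVC := integrable_lincomb 1 (- C) hV hi.
  have := integrable_lincomb a 1 hm hVC.
  have -> : (fun x => a * h x `^ m +
      1 * (1 * (h x * pot f x) + - C * h x)) = G h.
    by apply/funext => x; rewrite /G; ring.
  move=> Ghi; split=> //.
  transitivity (\int[mu]_x (a * h x `^ m +
      1 * (1 * (h x * pot f x) + - C * h x))).
    by apply: eq_Rintegral => x _; rewrite /G; ring.
  by rewrite Rintegral_lincomb// Rintegral_lincomb// h1; ring.
have [Gfi Gf] := Gi f fa; have [Gsi Gs] := Gi s sa.
have lemin := linearised_minimality fmin sa.
have GE (h : T -> R) x : G h x = a * h x `^ m - (C - pot f x) * h x.
  by rewrite /G; ring.
have Glt x : f x != s x -> G s x < G f x.
  by move=> fs; rewrite !GE; exact: (best_density_min m1 a0 (f0 x) fs).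
have := @Rintegral_eq0_ae _ _ _ mu (fun x => G f x - G s x) _ _ _.
case.
- have := integrable_lincomb 1 (-1) Gfi Gsi.
  by apply: eq_integrable => // x _; congr EFin => /=; ring.
- move=> x; rewrite subr_ge0; have [|/Glt/ltW//] := eqVneq (f x) (s x).
  by rewrite /G => ->.
- rewrite RintegralB// Gf Gs opprB addrA subrK subr_le0.
  exact: lemin.
move=> N [mN N0 sub]; exists N; split=> //.
apply: subset_trans sub => x /= fs /eqP; rewrite subr_eq0 => /eqP Gfs.
by apply: fs; apply/eqP; apply: contraT => /Glt; rewrite Gfs ltxx.
Qed.

End minimisers.

(** * Periodic functions on the torus *)

Section row_vectors.
Context {R : realType}.

Lemma nbhs_rV d (x : 'rV[R]_d) (A : set 'rV[R]_d) : nbhs x A ->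
  exists2 e : R, 0 < e &
    forall y : 'rV[R]_d, (forall i, `|x ord0 i - y ord0 i| < e) -> A y.
Proof.
move=> /nbhs_ballP[e /= e0 eA]; exists e => // y xy; apply: eA.
by split=> // i j; rewrite ord1; exact: xy.
Qed.

Lemma continuous_rV (T : topologicalType) d (phi : T -> 'rV[R]_d) :
  (forall i, continuous (fun x => phi x ord0 i)) -> continuous phi.
Proof.
move=> cphi x A [P nP sPA].
have : \forall y \near x, forall i, P ord0 i (phi y ord0 i).
  by apply: filter_forall => i; apply: cphi; exact: nP.
by apply: filterS => y Py; apply: sPA => i j; rewrite (ord1 i); exact: Py.
Qed.

(** The sigma-algebra on tuples is a product one, so continuity only gives
    measurability through the countable basis of rational boxes: an open set is
    the union of the boxes it contains. *)
Lemma measurable_comp_rV dT (T : measurableType dT) d (phi : T -> 'rV[R]_d)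
    (W : 'rV[R]_d -> R) :
  (forall i, measurable_fun setT (fun x => phi x ord0 i : R)) -> continuous W ->
  measurable_fun setT (W \o phi).
Proof.
move=> mphi cW; apply: (measurability _ (RGenOInfty.measurableE R)) => //.
move=> _ [_ [r ->] <-]; rewrite setTI.
pose box (k : 'rV[rat]_d * nat) : set 'rV[R]_d :=
  [set y | forall i, `|ratr (k.1 ord0 i) - y ord0 i| < (k.2.+1%:R)^-1].
pose B k :=
  if `[< box k `<=` [set y | r < W y] >] then phi @^-1` box k else set0.
rewrite (_ : _ @^-1` _ = \bigcup_k B k).
  apply: countable_bigcupT_measurable => // k.
  rewrite /B; case: ifP => // _.
  have -> : phi @^-1` box k = \bigcap_(i in [set: 'I_d])
      [set x | `|ratr (k.1 ord0 i) - phi x ord0 i| < (k.2.+1%:R)^-1].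
    by apply/seteqP; split=> x /= h i => [_|]; exact: h.
  apply: fin_bigcap_measurable => // i _.
  have mh : measurable_fun setT
      (fun x => `|ratr (k.1 ord0 i) - phi x ord0 i| : R).
    by apply: measurableT_comp => //; exact: measurable_funB.
  rewrite -[X in measurable X]setTI.
  rewrite (_ : mkset _ = (fun x => `|ratr (k.1 ord0 i) - phi x ord0 i|) @^-1`
      `]-oo, k.2.+1%:R^-1[).
    by apply: mh => //; exact: measurable_itv.
  by apply/seteqP; split=> x; rewrite /= in_itv.
apply/seteqP; split=> [x|x [k _]].
  rewrite /= in_itv/= andbT => rW.
  have /nbhs_rV[e e0 eW] : nbhs (phi x) [set y | r < W y].
    exact: (cW _ _ (lt_nbhsr rW)).
  have [n ne] : exists n, (n.+1%:R)^-1 < e / 2.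
    by apply: invSn_lt; rewrite divr_gt0.
  have n0 : (0 : R) < (n.+1%:R)^-1 by rewrite invr_gt0.
  have /choice[q qx] : forall i, exists q : rat,
      `|ratr q - phi x ord0 i| < (n.+1%:R)^-1.
    move=> i; have : phi x ord0 i - (n.+1%:R)^-1 < phi x ord0 i + (n.+1%:R)^-1.
      by rewrite ltrBlDr -addrA ltrDl addr_gt0.
    move=> /rat_in_itvoo[q]; rewrite in_itv/= => qI; exists q.
    by rewrite distrC ltr_distlC.
  exists (\row_i q i, n) => //; rewrite /B.
  have bx : box (\row_i q i, n) (phi x) by move=> i; rewrite /= mxE; exact: qx.
  case: asboolP => // -[] y by_ /=; apply: eW => i.
  rewrite distrC -(subrK (ratr (q i)) (y ord0 i)) -addrA.
  rewrite (le_lt_trans (ler_normD _ _))// (splitr e).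
  have := by_ i; rewrite /= mxE distrC => h1.
  by rewrite ltrD// ?(lt_trans (qx i))// (lt_trans h1).
rewrite /B; case: asboolP => // sub bx.
by rewrite /= in_itv/= andbT; exact: sub.
Qed.

End row_vectors.

Section one_dim_shift.
Context {R : realType} (L : {posnum R}).
Local Notation mu := (@lebesgue_measure R).
Local Notation l := (L%:num).

Lemma circle_leb_integral (G : R -> R) : continuous G ->
  (\int[circle_leb L]_x (G x)%:E = (\int[mu]_(x in `[0%R, l]) G x)%:E)%E.
Proof.
move=> cG; have mG : measurable_fun setT G by exact: continuous_measurable_fun.
have Gi : mu.-integrable `[0, l] (EFin \o G).
  apply: continuous_compact_integrable; first exact: segment_compact.
  exact: continuous_subspaceT.
have Gi' : mu.-integrable `[0, l[ (EFin \o G).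
  by apply: integrableS Gi => //; exact: subset_itv_co_cc.
rewrite -Rintegral_itv_bndo_bndc// /Rintegral fineK; last first.
  exact: integrable_fin_num.
transitivity (\int[circle_leb L]_(x in `[0%R, l[) (G x)%:E)%E.
  rewrite [RHS]integral_mkcond; apply: ae_eq_integral => //.
  - exact/measurable_EFinP.
  - apply/(measurable_restrictT _ _).1 => //.
    by apply: measurable_funTS; exact/measurable_EFinP.
  - exists (~` `[0, l[); split.
    + exact: measurableC.
    + by rewrite -[LHS]/(mu (~` `[0, l[ `&` `[0, l[)) setICl measure0.
    + by move=> x /= h xI; apply: h => _; rewrite patchE mem_set.
apply: eq_measure_integral => A mA AI.
by rewrite -[LHS]/(mu (A `&` `[0, l[)) setIidl.
Qed.

Lemma Rintegral_shift (G : R -> R) (a b s : R) : continuous G -> a <= b ->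
  \int[mu]_(x in `[a, b]) G (x - s) = \int[mu]_(x in `[a - s, b - s]) G x.
Proof.
move=> cG ab; rewrite /Rintegral; congr fine.
have dF x : is_derive x (1 : R) (fun x : R => x - s) 1.
  rewrite -[X in is_derive _ _ _ X](subr0 (1 : R)).
  exact: (@is_deriveB _ _ _ id (cst s) x 1 1 0).
have F1 : derive1 (fun x : R => x - s) = cst 1.
  by apply/funext => x; rewrite derive1E; exact: derive_val.
rewrite (@integration_by_substitution_increasing _ (fun x => x - s) G a b)//.
- by apply: eq_integral => x _; rewrite F1 /= mulr1.
- by move=> x y _ _; rewrite ltrD2r.
- by rewrite F1 => x _; exact: cvg_cst.
- by rewrite F1; exact: is_cvg_cst.
- by rewrite F1; exact: is_cvg_cst.
- split=> //.
  + by apply: cvg_at_right_filter; apply: cvgB; [exact: cvg_id|exact: cvg_cst].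
  + by apply: cvg_at_left_filter; apply: cvgB; [exact: cvg_id|exact: cvg_cst].
- exact: continuous_subspaceT.
Qed.

(** The shifted integral runs over [- s, L - s], which is [0, L] with [L - s, L]
    replaced by its translate [- s, 0] by one period. *)
Lemma circle_shift (G : R -> R) (s : R) : continuous G ->
  (forall x, G (x + l) = G x) -> 0 <= s <= l ->
  (\int[circle_leb L]_x (G (x - s))%:E = \int[circle_leb L]_x (G x)%:E)%E.
Proof.
move=> cG per /andP[s0 sl]; have l0 : 0 < l by [].
have cGs : continuous (fun x => G (x - s)).
  move=> x; apply: (@cvg_comp _ _ _ (fun x => x - s) G _ (nbhs (x - s))).
    by apply: cvgB; [exact: cvg_id|exact: cvg_cst].
  exact: cG.
rewrite !circle_leb_integral//; congr EFin.
rewrite Rintegral_shift ?ltW// sub0r.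
have Gi (a b : R) : mu.-integrable `[a, b] (EFin \o G).
  apply: continuous_compact_integrable; first exact: segment_compact.
  exact: continuous_subspaceT.
have split (a b x : R) : a <= x -> x <= b ->
    \int[mu]_(t in `[a, b]) G t =
    \int[mu]_(t in `[a, x]) G t + \int[mu]_(t in `[x, b]) G t.
  move=> ax xb; have := @Rintegral_itvB _ G (BLeft a) (BRight b) x (Gi a b).
  rewrite !bnd_simp => /(_ ax xb); rewrite Rintegral_itv_obnd_cbnd.
    by move=> <-; rewrite addrC subrK.
  by apply: integrableS (Gi x b) => //; exact: subset_itv_oc_cc.
rewrite (split (- s) (l - s) 0) ?oppr_le0 ?subr_ge0//.
rewrite (split 0 l (l - s)) ?subr_ge0// ?gerBl// addrC; congr (_ + _).
have lsl : l - s <= l by rewrite gerBl.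
have := Rintegral_shift l cG lsl.
rewrite subrr (_ : l - s - l = - s); last by ring.
move=> <-; apply: eq_Rintegral => x _.
by rewrite -[in RHS](subrK l x) per.
Qed.

End one_dim_shift.

Section torus_shift.
Context {R : realType} (L : {posnum R}).
Local Notation l := (L%:num).

Definition row_cons d (t : R) (y : 'rV[R]_d) : 'rV[R]_d.+1 :=
  \row_i oapp (y ord0) t (unlift ord0 i).

Lemma row_cons0 d t (y : 'rV[R]_d) : row_cons t y ord0 ord0 = t.
Proof. by rewrite mxE unlift_none. Qed.

Lemma row_cons_lift d t (y : 'rV[R]_d) i :
  row_cons t y ord0 (lift ord0 i) = y ord0 i.
Proof. by rewrite mxE liftK. Qed.

Lemma row_consP d (x y : 'rV[R]_d.+1) : x ord0 ord0 = y ord0 ord0 ->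
  (forall i, x ord0 (lift ord0 i) = y ord0 (lift ord0 i)) -> x = y.
Proof.
by move=> h0 hS; apply/rowP => j; case: (unliftP ord0 j) => [i ->|->].
Qed.

Lemma vec_cons d (p : measurableTypeR R * Rd R d) :
  vec (Rd_cons p) = row_cons p.1 (vec p.2).
Proof.
apply: row_consP => [|i]; first by rewrite row_cons0 mxE.
by rewrite row_cons_lift !mxE tnthS.
Qed.

Lemma continuous_row_consl d (y : 'rV[R]_d) :
  continuous (fun t : R => row_cons t y).
Proof.
apply: continuous_rV => j; case: (unliftP ord0 j) => [i ->|->].
  under eq_fun do rewrite row_cons_lift; exact: cst_continuous.
by under eq_fun do rewrite row_cons0; move=> x; exact: cvg_id.
Qed.

Lemma continuous_row_consr d (t : R) : continuous (@row_cons d t).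
Proof.
apply: continuous_rV => j; case: (unliftP ord0 j) => [i ->|->].
  under eq_fun do rewrite row_cons_lift; exact: coord_continuous.
by under eq_fun do rewrite row_cons0; exact: cst_continuous.
Qed.

(** Every point is a translate, by integer multiples of the periods, of a point
    of the compact cube [0, L] ^ d. *)
Lemma torus_periodic_bounded d (W : 'rV[R]_d -> R) :
  continuous W -> torus_periodic L W -> exists M, forall x, `|W x| <= M.
Proof.
move=> cW per.
have pern i (n : nat) x : W (x + (n%:R * l) *: delta_mx ord0 i) = W x.
  elim: n x => [|n IH] x; first by rewrite mul0r scale0r addr0.
  by rewrite -natr1 mulrDl mul1r scalerDl addrA per IH.
have perz i (n : int) x : W (x + (n%:~R * l) *: delta_mx ord0 i) = W x.
  case: n => n; first exact: pern.
  rewrite NegzE -[in RHS](subrK ((n.+1%:R * l) *: delta_mx ord0 i) x) pern.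
  by rewrite mulrNz mulNr scaleNr.
have perv (k : 'I_d -> int) x :
    W (x + \sum_i ((k i)%:~R * l) *: delta_mx ord0 i) = W x.
  by elim/big_rec: _ x => [x|i y _ IH x]; rewrite ?addr0// addrA IH perz.
pose A := [set v : 'rV[R]_d | forall i, `[0, l]%classic (v ord0 i)].
have cA : compact A.
  exact: (@rV_compact _ d (fun=> `[0, l]%classic)
    (fun=> @segment_compact _ _ _)).
have /compact_bounded[M [_ HM]] : compact (W @` A).
  by apply: continuous_compact => //; exact: continuous_subspaceT.
exists (M + 1) => x; apply: (HM (M + 1)); first by rewrite ltrDl.
pose k i := - Num.floor (x ord0 i / l).
exists (x + \sum_i ((k i)%:~R * l) *: delta_mx ord0 i); last exact: perv.
move=> i; rewrite mxE summxE (bigD1 i)//= big1 ?addr0; last first.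
  by move=> j ji; rewrite !mxE eqxx/= eq_sym (negbTE ji) mulr0.
rewrite !mxE !eqxx mulr1 /k mulrNz mulNr in_itv/=.
have := floor_itv (x ord0 i / l); rewrite intrD => /andP[fl flD1].
rewrite subr_ge0 -ler_pdivlMr// fl/= lerBlDr.
by rewrite -[X in _ <= X + _]mul1r -mulrDl -ler_pdivrMr// addrC ltW.
Qed.

Lemma measurable_vec_comp dT (T : measurableType dT) d (W : 'rV[R]_d -> R)
    (phi : T -> Rd R d) (v : 'rV[R]_d) : continuous W ->
  measurable_fun setT phi -> measurable_fun setT (fun x => W (vec (phi x) - v)).
Proof.
move=> cW mphi.
apply: (@measurable_comp_rV _ _ _ _ (fun x => vec (phi x) - v)) => // i.
under eq_fun do rewrite !mxE.
apply: measurable_funB => //.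
exact: (measurableT_comp (@measurable_tnth _ (measurableTypeR R) d i) mphi).
Qed.

(** Translation invariance, one coordinate at a time: the induction hypothesis
    shifts all coordinates but the first, Fubini's theorem brings the first one
    inside, and the one-dimensional case shifts it. *)
Lemma torus_shift d (W : 'rV[R]_d -> R) (v : 'rV[R]_d) :
  continuous W -> torus_periodic L W -> (forall i, 0 <= v ord0 i <= l) ->
  (\int[torus_leb L d]_x (W (vec x - v))%:E =
   \int[torus_leb L d]_x (W (vec x))%:E)%E.
Proof.
elim: d W v => [|d IH] W v cW per v0.
  apply: eq_integral => x _; congr (W _)%:E.
  by apply/rowP => -[].
have [M WM] := torus_periodic_bounded cW per.
pose v' : 'rV[R]_d := \row_i v ord0 (lift ord0 i).
pose prod := (circle_leb L \x torus_leb L d)%E.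
have mW u : measurable_fun setT (fun p => W (vec (@Rd_cons R d p) - u)).
  by apply: measurable_vec_comp => //; exact: measurable_Rd_cons.
have iW u : prod.-integrable setT (EFin \o (fun p => W (vec (Rd_cons p) - u))).
  apply: measurable_bounded_integrable => //.
    rewrite -[ltLHS]/((circle_leb L \x torus_leb L d)%E setT) -setXTT.
    rewrite product_measure1E// lte_mul_pinfty// ?fin_num_measure//.
    by rewrite -ge0_fin_numE// fin_num_measure.
  exists M; split; first exact: num_real.
  by move=> N MN x _; exact: le_trans (WM _) (ltW MN).
have push u : (\int[torus_leb L d.+1]_x (W (vec x - u))%:E =
    \int[prod]_p (W (vec (Rd_cons p) - u))%:E)%E.
  apply: (@integral_pushforward _ _ _ _ _ (@Rd_cons R d)
    (@measurable_Rd_cons R d) prod setT (fun x => (W (vec x - u))%:E)) => //.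
    by apply/measurable_EFinP; exact: measurable_vec_comp.
  by rewrite preimage_setT; exact: iW.
have cWc (t : R) : continuous (fun y : 'rV[R]_d => W (row_cons t y)).
  move=> y; apply: (@continuous_comp _ _ _ (@row_cons d t) W).
    exact: continuous_row_consr.
  exact: cW.
have perc (t : R) : torus_periodic L (fun y : 'rV[R]_d => W (row_cons t y)).
  move=> i y; rewrite -[RHS](per (lift ord0 i)); congr W.
  apply: row_consP => [|j]; first by rewrite !mxE unlift_none/= mulr0 addr0.
  by rewrite !mxE !liftK/= !mxE (inj_eq lift_inj) eqxx.
have shiftE t x : row_cons t x - v = row_cons (t - v ord0 ord0) (x - v').
  by apply: row_consP => [|i]; rewrite mxE !mxE ?unlift_none ?liftK//= !mxE.
transitivity (\int[circle_leb L]_t \int[torus_leb L d]_x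
    (W (row_cons (t - v ord0 ord0) (vec x)))%:E)%E.
  rewrite push -(integral12_prod_meas1 (iW v)); apply: eq_integral => t _.
  rewrite /fubini_F/=.
  rewrite -(IH (fun y => W (row_cons (t - v ord0 ord0) y)) v')//; last first.
    by move=> i; rewrite mxE.
  by apply: eq_integral => x _; rewrite vec_cons shiftE.
(* The shift in the first coordinate alone, to which Fubini's theorem applies. *)
pose u : 'rV[R]_d.+1 := row_cons (v ord0 ord0) 0.
have uE t x : row_cons t x - u = row_cons (t - v ord0 ord0) x.
  apply: row_consP => [|i]; rewrite /u !mxE ?unlift_none ?liftK//=.
  by rewrite ?mxE ?subr0.
transitivity (\int[torus_leb L d]_x \int[circle_leb L]_t
    (W (row_cons (t - v ord0 ord0) (vec x)))%:E)%E.
  transitivity (\int[circle_leb L]_t \int[torus_leb L d]_x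
      (W (vec (Rd_cons (t, x)) - u))%:E)%E.
    apply: eq_integral => t _; apply: eq_integral => x _.
    by rewrite vec_cons uE.
  rewrite (Fubini (iW u)).
  apply: eq_integral => x _; apply: eq_integral => t _.
  by rewrite /= vec_cons uE.
transitivity (\int[torus_leb L d]_x \int[circle_leb L]_t
    (W (row_cons t (vec x)))%:E)%E.
  apply: eq_integral => x _.
  apply: (circle_shift (G := fun t => W (row_cons t (vec x)))) => //.
    move=> t; apply: (@continuous_comp _ _ _
      (fun t : R => row_cons t (vec x)) W).
      exact: continuous_row_consl.
    exact: cW.
  move=> t; rewrite -[RHS](per ord0); congr W.
  apply: row_consP => [|j]; first by rewrite !mxE unlift_none/= mulr1.
  by rewrite !mxE liftK/= mulr0 addr0.
have := push 0; under eq_integral do rewrite subr0.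
move=> ->; rewrite -(integral21_prod_meas1 (iW 0)); apply: eq_integral => x _.
by rewrite /fubini_G/=; apply: eq_integral => t _; rewrite vec_cons subr0.
Qed.

End torus_shift.

(** * Probability measures on the torus and their densities *)

Section probability_of_density.
Context dT {T : measurableType dT} {R : realType}.
Variable mu : {finite_measure set T -> \bar R}.

Lemma probability_of_density (f : T -> R) : (forall x, 0 <= f x) ->
  mu.-integrable setT (EFin \o f) -> \int[mu]_x f x = 1 ->
  exists rho : probability T R,
    forall A, measurable A -> (rho A = \int[mu]_(x in A) (f x)%:E)%E.
Proof.
move=> f0 fi f1.
pose nu (A : set T) := (\int[mu]_(x in A) (f x)%:E)%E.
have nu0 : (nu set0 = 0)%E by rewrite /nu integral_set0.
have nu_ge0 A : (0 <= nu A)%E.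
  by apply: integral_ge0 => x _; rewrite lee_fin.
have nu_sigma : semi_sigma_additive nu.
  move=> A mA tA mUA; rewrite /nu integral_bigcup//=; last first.
    by apply: (integrableS _ _ (subsetT _)).
  apply: is_cvg_ereal_nneg_natsum_cond => n _ _.
  by apply: integral_ge0 => x _; rewrite lee_fin.
pose M : {measure set T -> \bar R} :=
  HB.pack nu (isMeasure.Build _ _ _ nu nu0 nu_ge0 nu_sigma).
have M1 : (M setT = 1)%E.
  rewrite -[LHS]/(nu setT) /nu.
  rewrite -[LHS]fineK ?(integrable_fin_num measurableT fi)//.
  by rewrite -[X in X%:E]/(\int[mu]_x f x) f1.
pose P : probability T R :=
  HB.pack nu (isMeasure.Build _ _ _ nu nu0 nu_ge0 nu_sigma)
    (Measure_isProbability.Build _ _ _ M M1).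
by exists P.
Qed.

End probability_of_density.

Section torus_functional.
Context {R : realType} {d : nat} (L : {posnum R}).
Local Notation T := (Rd R d).
Local Notation mu := (torus_leb L d).
Local Notation l := (L%:num).
Local Notation intg f := (mu.-integrable setT (EFin \o f)).

Lemma cell_box : cell L d =
  [set x : T | forall i, `[0, l[%classic (tnth x i : measurableTypeR R)].
Proof.
by apply/seteqP; split => x /= h i; have := h i; rewrite /= in_itv.
Qed.

Lemma measurable_cell : measurable (cell L d : set T).
Proof.
rewrite cell_box.
apply: (@measurable_box R d (fun=> `[0, l[%classic)) => i.
exact: measurable_itv.
Qed.

Lemma torus_leb_cellC : (mu (~` cell L d) = 0)%E.
Proof.
have mc := measurable_cell.
have muc : (mu (cell L d) = mu setT)%E.
  rewrite cell_box (@torus_leb_box R L d (fun=> `[0, l[%classic)); last first.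
    by move=> i; exact: measurable_itv.
  rewrite torus_lebT (eq_bigr (fun=> l%:E)); last first.
    by move=> i _; rewrite setIid lebesgue_itv0L.
  by rewrite prodEFin prodr_const card_ord.
have muT : (mu setT < +oo)%E by rewrite -ge0_fin_numE// fin_num_measure.
rewrite -setTD measureD// setTI.
by rewrite [X in (_ - X)%E]muc subee// fin_num_measure.
Qed.

Lemma torus_leb_gt0 : (0 < mu setT)%E.
Proof. by rewrite torus_lebT lte_fin exprn_gt0. Qed.

Lemma torus_leb_volume : fine (mu setT) = l ^+ d.
Proof. by rewrite torus_lebT. Qed.

Definition has_density (rho : probability T R) (f : T -> R) :=
  rho `<< mu /\ {ae mu, forall x, density L rho x = (f x)%:E}.

Lemma measurable_density (rho : probability T R) : rho `<< mu ->
  measurable_fun setT (density L rho).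
Proof.
move=> dom; apply: (@measurable_int _ _ _ mu).
exact: Radon_Nikodym_integrable.
Qed.

Lemma has_densityP (rho : probability T R) (f : T -> R) : intg f ->
  (forall A, measurable A -> (rho A = \int[mu]_(x in A) (f x)%:E)%E) ->
  has_density rho f.
Proof.
move=> fi rhoE; have dom : rho `<< mu.
  apply/null_content_dominatesP => A mA muA0; rewrite rhoE//.
  apply: null_set_integral => //.
  exact: measurable_funTS (measurable_int _ fi).
split=> //; have : ae_eq mu setT (density L rho) (EFin \o f).
  apply: integral_ae_eq => //.
  - exact: Radon_Nikodym_integrable.
  - exact: measurable_int fi.
  - by move=> A _ mA; rewrite -Radon_Nikodym_integral//= rhoE.
by apply: filterS => x /= /(_ I).
Qed.

(** The representative is chosen nonnegative everywhere and zero off the cell, so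
    that later estimates need no exceptional sets. *)
Lemma dominated_density (rho : probability T R) : in_P L rho -> rho `<< mu ->
  exists f : T -> R, [/\ has_density rho f, measurable_fun setT f,
    forall x, 0 <= f x, forall x, ~ cell L d x -> f x = 0 &
    intg f /\ \int[mu]_x f x = 1].
Proof.
move=> rhoc dom; have mc := measurable_cell.
pose g := Radon_Nikodym_SigmaFinite.f rho mu.
have g0 x : (0 <= g x)%E by exact: Radon_Nikodym_SigmaFinite.f_ge0.
have gfin x : g x \is a fin_num by exact: Radon_Nikodym_SigmaFinite.f_fin_num.
have gi : mu.-integrable setT g.
  exact: Radon_Nikodym_SigmaFinite.f_integrable.
have mg : measurable_fun setT g by exact: measurable_int gi.
pose f x := \1_(cell L d) x * fine (g x).
have mf : measurable_fun setT f.
  apply: measurable_funM; first exact: measurable_indic.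
  exact: (measurableT_comp (fine_measurable measurableT) mg).
have fae : {ae mu, forall x, g x = (f x)%:E}.
  exists (~` cell L d); split; first exact: measurableC.
    exact: torus_leb_cellC.
  move=> x /= h cx; apply: h; rewrite /f indicE mem_set// mul1r fineK//.
have fi : intg f.
  apply: le_integrable gi => //; first exact/measurable_EFinP.
  move=> x _ /=; rewrite /f indicE.
  case: (x \in _); rewrite ?mul1r ?mul0r ?normr0 ?abse_ge0//.
  by rewrite -abse_EFin fineK.
exists f; split=> //.
- split=> //.
  have := ae_eq_Radon_Nikodym_SigmaFinite dom measurableT.
  move: fae; apply: filterS2 => x /= <- /(_ I) h; exact: (esym h).
- by move=> x; rewrite /f mulr_ge0 ?fine_ge0.
- by move=> x cx; rewrite /f indicE memNset ?mul0r.
- split=> //; apply: EFin_inj; rewrite /Rintegral fineK; last first.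
    exact: integrable_fin_num.
  rewrite -(probability_setT rho).
  rewrite (@Radon_Nikodym_SigmaFinite.f_integral _ _ _ rho mu dom _
    measurableT).
  apply: ae_eq_integral => //; first exact/measurable_EFinP.
  by move: fae; apply: filterS => x h _; exact: (esym h).
Qed.

Lemma rho_inf_density : has_density (rho_inf L d) (fun=> l ^- d).
Proof.
apply: has_densityP.
  by apply: (@bounded_integrable _ _ _ _ _ `|l ^- d|).
by move=> A mA; rewrite integral_cst.
Qed.

Lemma in_P_density (rho : probability T R) : rho `<< mu -> in_P L rho.
Proof.
move=> /null_content_dominatesP dom; rewrite /in_P.
have mc := measurable_cell.
have z : (rho (~` cell L d) = 0)%E.
  by apply: dom; [exact: measurableC|exact: torus_leb_cellC].
apply: etrans (probability_setT rho).
rewrite -(setUv (cell L d)) measureU ?setICr//; last exact: measurableC.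
by rewrite [X in (_ + X)%E]z adde0.
Qed.

Lemma Linfty_dist_le (rho : probability T R) (f : T -> R) (e : R) :
  has_density rho f -> {ae mu, forall x, `|f x - l ^- d| <= e} ->
  (Linfty_dist L rho <= e%:E)%E.
Proof.
move=> [_ rf] fe; rewrite /Linfty_dist Lnorm.unlock torus_leb_gt0.
apply/ess_supP; move: rf fe; apply: filterS2 => x /= -> h.
by rewrite -EFinB lee_fin.
Qed.

Variables (W : 'rV[R]_d -> R).
Hypotheses (cW : continuous W) (perW : torus_periodic L W).

Definition kernel (z : T * T) : R := W (vec z.1 - vec z.2).

Lemma measurable_kernel : measurable_fun setT kernel.
Proof.
apply: (@measurable_comp_rV _ _ _ _
  (fun z : T * T => vec z.1 - vec z.2)) => // i.
under eq_fun do rewrite !mxE.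
have mt : measurable_fun setT (fun x : T => tnth x i : R).
  exact: (@measurable_tnth _ (measurableTypeR R) d i).
by apply: measurable_funB; apply: (measurableT_comp mt).
Qed.

Lemma kernel_bounded : exists M, forall z, `|kernel z| <= M.
Proof.
by have [M WM] := torus_periodic_bounded cW perW; exists M => z; exact: WM.
Qed.

(** Flipping all coordinates one after the other turns v into - v. *)
Lemma kernelC (x y : T) : even_coord W -> kernel (x, y) = kernel (y, x).
Proof.
move=> evW; rewrite /kernel/= -(opprB (vec y)).
move: (vec y - vec x) => v.
have flips (s : seq 'I_d) : uniq s ->
    W (\row_j (if j \in s then - v ord0 j else v ord0 j)) = W v.
  elim: s => [|i s IH] /=.
    by move=> _; congr W; apply/rowP => j; rewrite mxE.
  move=> /andP[iNs us]; rewrite -IH// -(evW i); congr W.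
  apply/rowP => j; rewrite !mxE inE; case: eqVneq => [->|//].
  by rewrite (negbTE iNs) opprK.
rewrite -(flips (enum 'I_d)) ?enum_uniq//; congr W; apply/rowP => j.
by rewrite !mxE mem_enum.
Qed.

Variables (m beta : R).
Hypotheses (m1 : 1 < m) (beta0 : 0 < beta).
Local Notation a := (beta^-1 / (m - 1)).

Lemma S_density (rho : probability T R) (f : T -> R) :
  has_density rho f -> measurable_fun setT f ->
  (S_ L m beta rho = a%:E * \int[mu]_x (f x `^ m)%:E - a%:E)%E.
Proof.
move=> [dom rf] mf; rewrite /S_ asboolT//; congr (_ * _ - _)%E.
apply: ae_eq_integral => //.
- apply: (measurableT_comp (measurable_poweR _)).
  exact: measurable_density.
- by apply/measurable_EFinP; exact: measurable_funpowR.
- by move: rf; apply: filterS => x ->.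
Qed.

Lemma ae_product (P Q : T -> Prop) : {ae mu, forall x, P x} ->
  {ae mu, forall x, Q x} ->
  {ae (mu \x mu)%E, forall z, P z.1 /\ Q z.2}.
Proof.
move=> [A [mA A0 PA]] [B [mB B0 QB]].
exists ((A `*` setT) `|` (setT `*` B)); split.
- by apply: measurableU; exact: measurableX.
- apply/null_set_setU; rewrite -?[LHS]/((mu \x mu)%E _).
  + exact: measurableX.
  + exact: measurableX.
  + by rewrite product_measure1E// [X in (X * _)%E]A0 mul0e.
  + by rewrite product_measure1E// [X in (_ * X)%E]B0 mule0.
- move=> [x y] /= /not_andP[Px|Qy]; [left|right]; split=> //=.
    exact: PA.
  exact: QB.
Qed.

Lemma E_density (rho : probability T R) (f : T -> R) :
  has_density rho f -> measurable_fun setT f -> intg f ->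
  E_ L W rho = (2^-1 * interaction mu kernel f f)%:E.
Proof.
move=> [dom rf] mf fi; have [M KM] := kernel_bounded.
rewrite EFinM /E_; congr (_ * _)%E.
have Ki := integrable_interaction measurable_kernel KM fi fi.
rewrite /interaction /Rintegral fineK; last exact: integrable_fin_num.
have md : measurable_fun setT (density L rho).
  exact: measurable_density.
apply: ae_eq_integral => //.
- apply: emeasurable_funM; last exact: (measurableT_comp md).
  apply: emeasurable_funM; last exact: (measurableT_comp md).
  by apply/measurable_EFinP; exact: measurable_kernel.
- exact: measurable_int Ki.
- by move: (ae_product rf rf); apply: filterS => z /= [-> ->].
Qed.

Lemma F_density (rho : probability T R) (f : T -> R) :
  has_density rho f -> admissible mu m f ->
  F_ L W m beta rho = (energy mu kernel m a f - a)%:E.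
Proof.
move=> rf [mf f0 fi f1 fm].
rewrite /F_ (S_density rf mf) (E_density rf mf fi).
rewrite -[X in (_ * X)%E]fineK ?(integrable_fin_num measurableT fm)//.
by rewrite -EFinM -EFinB/= -EFinD /energy /Rintegral addrAC.
Qed.

(** A finite entropy forces absolute continuity and a finite integral of f ^ m. *)
Lemma F_finite_admissible (rho : probability T R) : in_P L rho ->
  (F_ L W m beta rho < +oo)%E ->
  exists f : T -> R, [/\ has_density rho f, admissible mu m f &
    forall x, ~ cell L d x -> f x = 0].
Proof.
move=> rhoP; rewrite /F_; case: ifPn => // /andP[Sfin _] _.
have dom : rho `<< mu.
  by move: Sfin; rewrite /S_; case: ifPn => // /asboolP.
have [f [rf mf f0 fc [fi f1]]] := dominated_density rhoP dom.
exists f; split=> //; split=> //.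
move: Sfin; rewrite (S_density rf mf) => Sfin.
have a0 : 0 < a by rewrite divr_gt0 ?invr_gt0// subr_gt0.
apply/integrableP; split.
  by apply/measurable_EFinP; exact: measurable_funpowR.
under eq_integral do rewrite /= ger0_norm ?powR_ge0//.
rewrite ltey; apply/eqP => h; move: Sfin; rewrite h gt0_muley ?lte_fin//.
Qed.

End torus_functional.

(** * Compactness of minimisers *)

Section minimiser_profiles.
Context {R : realType} {d : nat} (L : {posnum R}) (W : 'rV[R]_d -> R) (m : R).
Hypotheses (cW : continuous W) (perW : torus_periodic L W).
Hypotheses (evW : even_coord W) (m1 : 1 < m).
Local Notation T := (Rd R d).
Local Notation mu := (torus_leb L d).
Local Notation l := (L%:num).
Local Notation K := (@kernel R d W).
Local Notation intg f := (mu.-integrable setT (EFin \o f)).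
Local Notation coeff beta := (beta^-1 / (m - 1)).
Local Notation c := (l ^- d).
Implicit Types (beta : R) (rho : probability T R) (f g : T -> R).

Let mK := measurable_kernel cW.

Lemma coeff_gt0 beta : 0 < beta -> 0 < coeff beta.
Proof. by move=> b0; rewrite divr_gt0 ?invr_gt0// subr_gt0. Qed.

Lemma uniform_density_gt0 : 0 < c :> R.
Proof. by rewrite invr_gt0 exprn_gt0. Qed.

Lemma Rintegral_uniform : \int[mu]_x c = 1.
Proof.
by rewrite Rintegral_cst// torus_leb_volume mulVf// gt_eqF// exprn_gt0.
Qed.

Lemma admissible_uniform : admissible mu m (fun=> c).
Proof.
apply: (@bounded_admissible _ _ _ mu m m1 _ c) => //; last first.
  exact: Rintegral_uniform.
by move=> x; rewrite lexx ltW// uniform_density_gt0.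
Qed.

Lemma F_uniform beta :
  F_ L W m beta (rho_inf L d) =
  (energy mu K m (coeff beta) (fun=> c) - coeff beta)%:E.
Proof.
exact: (F_density cW perW beta (rho_inf_density L) admissible_uniform).
Qed.

Lemma admissible_probability g : admissible mu m g ->
  exists rho, in_P L rho /\ has_density L rho g.
Proof.
move=> [mg g0 gi g1 _]; have [rho rhoE] := probability_of_density g0 gi g1.
have rg := has_densityP gi rhoE; exists rho; split=> //.
by apply: in_P_density; case: rg.
Qed.

Lemma minimiser_energy beta rho : 0 < beta -> minimiser L W m beta rho ->
  exists f, [/\ has_density L rho f, energy_minimiser mu K m (coeff beta) f &
    forall x, ~ cell L d x -> f x = 0].
Proof.
move=> b0 [rhoP rhomin].
have Ffin : (F_ L W m beta rho < +oo)%E.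
  have [rc _] := rho_inf_density L (d := d).
  by rewrite (le_lt_trans (rhomin _ (in_P_density rc)))// F_uniform ltry.
have [f [rf fa fc]] := F_finite_admissible m1 b0 rhoP Ffin.
exists f; split=> //; split=> // g ga.
have [nu [nuP nug]] := admissible_probability ga.
have := rhomin nu nuP.
rewrite (F_density cW perW beta rf fa) (F_density cW perW beta nug ga).
by rewrite lee_fin lerD2r.
Qed.

(** The estimate on C, uniform in rho, is what makes the profiles of different
    minimisers comparable. *)
Lemma minimiser_profile M beta rho : (forall x, `|W x| <= M) -> 0 < beta ->
  minimiser L W m beta rho ->
  exists (C : R) f, [/\ has_density L rho f, admissible mu m f,
    forall x, ~ cell L d x -> f x = 0,
    `|C - coeff beta * m * c `^ (m - 1)| <= M &
    {ae mu, forall x,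
      f x = best_density m (coeff beta) (C - potential mu K f x)}].
Proof.
move=> WM b0 rhomin; have [f [rf fmin fc]] := minimiser_energy b0 rhomin.
have [C CM fE] := euler_lagrange mK (fun z => WM _) (fun x y => kernelC x y evW)
  m1 (coeff_gt0 b0) (torus_leb_gt0 L) fmin.
exists C, f; split=> //; first by case: fmin.
by rewrite torus_leb_volume in CM.
Qed.

Definition closed_cell : set 'rV[R]_d :=
  [set v | forall i, `[0, l]%classic (v ord0 i)].

Lemma compact_closed_cell : compact closed_cell.
Proof.
exact: (@rV_compact _ d (fun=> `[0, l]%classic)
  (fun=> @segment_compact _ _ _)).
Qed.

Lemma vec_cell (x : T) : cell L d x -> closed_cell (vec x).
Proof.
by move=> cx i; rewrite /= mxE in_itv/=; have /andP[-> /ltW] := cx i.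
Qed.

(** The potential of f at an arbitrary row: row vectors carry the topology, tuples
    the measure, and compactness arguments need the former. *)
Definition rV_potential f (x : 'rV[R]_d) : R :=
  \int[mu]_y (W (x - vec y) * f y).

Lemma measurable_W_sub (x : 'rV[R]_d) :
  measurable_fun setT (fun y : T => W (x - vec y)).
Proof.
apply: (@measurable_comp_rV _ _ _ _ (fun y : T => x - vec y)) => // i.
under eq_fun do rewrite !mxE.
apply: measurable_funB => //.
exact: (@measurable_tnth _ (measurableTypeR R) d i).
Qed.

Lemma rV_potential_bound M f x : (forall x, `|W x| <= M) ->
  admissible mu m f -> `|rV_potential f x| <= M.
Proof.
move=> WM [mf f0 fi f1 _].
apply: (@average_bound _ _ _ _ _ _ M) => //; first exact: measurable_W_sub.
by move=> y; rewrite ler_wpM2r.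
Qed.

(** Heine-Cantor in the variable y, from compactness of the closed cell. *)
Lemma W_sub_equicontinuous (x : 'rV[R]_d) (e : R) : 0 < e ->
  \forall x' \near x, forall y, closed_cell y ->
    `|W (x - y) - W (x' - y)| <= e.
Proof.
move=> e0; apply: ((compact_near_coveringP closed_cell).1 compact_closed_cell
  _ (nbhs x) (fun x' y => `|W (x - y) - W (x' - y)| <= e)) => y _.
have e20 : 0 < e / 2 by rewrite divr_gt0.
have cWB : continuous (fun z : 'rV[R]_d * 'rV[R]_d => W (z.1 - z.2)).
  move=> z; apply: (@continuous_comp _ _ _
    (fun z : 'rV[R]_d * 'rV[R]_d => z.1 - z.2) W); last exact: cW.
  by apply: cvgB; [exact: cvg_fst|exact: cvg_snd].
have /cvgrPdist_le/(_ _ e20)[[U V] /= [Ux Vy] UV] := cWB (x, y).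
exists (V, U) => //= -[y' x'] /= [Vy' Ux'].
have h1 := UV (x, y') (conj (nbhs_singleton Ux) Vy').
have h2 := UV (x', y') (conj Ux' Vy').
rewrite (le_trans (ler_distD (W (x - y)) _ _))// (splitr e) distrC.
by rewrite lerD.
Qed.

Lemma rV_potential_equicontinuous (x : 'rV[R]_d) (e : R) : 0 < e ->
  \forall x' \near x, forall f, admissible mu m f ->
    (forall x, ~ cell L d x -> f x = 0) ->
    `|rV_potential f x - rV_potential f x'| <= e.
Proof.
move=> e0; have [M WM] := torus_periodic_bounded cW perW.
have := W_sub_equicontinuous x e0; apply: filterS => x' xx' f.
move=> [mf f0 fi f1 _] fc; rewrite /rV_potential.
have Wfi z : intg (fun y => W (z - vec y) * f y).
  apply: (@bounded_integrableM _ _ _ mu _ _ M) => //.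
  exact: measurable_W_sub.
rewrite -RintegralB//.
under eq_Rintegral do rewrite -mulrBl.
apply: (@average_bound _ _ _ mu _ _ (M + M)) => //.
- by apply: measurable_funB; exact: measurable_W_sub.
- by move=> y; rewrite (le_trans (ler_normB _ _))// lerD.
- move=> y; have [cy|ncy] := pselect (cell L d y).
    by rewrite ler_wpM2r// xx'//; exact: vec_cell.
  by rewrite fc// !mulr0.
Qed.

End minimiser_profiles.

Section compactness_of_minimisers.
Context {R : realType} {d : nat} (L : {posnum R}) (W : 'rV[R]_d -> R) (m : R).
Hypotheses (cW : continuous W) (perW : torus_periodic L W).
Hypotheses (evW : even_coord W) (m1 : 1 < m).
Local Notation T := (Rd R d).
Local Notation mu := (torus_leb L d).
Local Notation l := (L%:num).
Local Notation K := (@kernel R d W).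
Local Notation intg f := (mu.-integrable setT (EFin \o f)).
Local Notation coeff beta := (beta^-1 / (m - 1)).
Local Notation c := (l ^- d).
Variable betac : R.
Hypothesis betac0 : 0 < betac.

(** By the Euler-Lagrange equation a minimiser equals, on the cell, a fixed
    continuous function p of (C - V) / (a m), where V is its potential.  These
    arguments are bounded and equicontinuous uniformly in beta, so the
    Arzela-Ascoli theorem applies to them and yields densities converging
    uniformly, not just weakly. *)
Lemma minimisers_precompact (beta : nat -> R) (rho : nat -> probability T R) :
  (forall n, betac < beta n <= betac + 1) ->
  (forall n, minimiser L W m (beta n) (rho n)) ->
  exists (B : R) (j : nat -> nat) (g : nat -> T -> R) (h : T -> R),
   [/\ forall n, (n <= j n)%N,
       forall n, has_density L (rho (j n)) (g n) /\ measurable_fun setT (g n),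
       forall n x, 0 <= g n x <= B,
       forall n, \int[mu]_x g n x = 1 &
       forall n x, `|g n x - h x| <= (n.+1%:R)^-1].
Proof.
move=> betaI rhomin; have [M WM] := torus_periodic_bounded cW perW.
have b0 n : 0 < beta n by have /andP[/(lt_trans betac0)] := betaI n.
have m0 : 0 < m by apply: lt_trans m1.
have /choice[C /choice[f fP]] n :=
  minimiser_profile cW perW evW m1 WM (b0 n) (rhomin n).
pose k := (betac + 1) * (m - 1) / m.
have kn n : (coeff (beta n) * m)^-1 = beta n * (m - 1) / m.
  by field; rewrite ?gt_eqF// ?subr_gt0.
have k0 : 0 < k.
  by rewrite divr_gt0// mulr_gt0// ?subr_gt0// addr_gt0.
have knk n : 0 <= (coeff (beta n) * m)^-1 <= k.
  rewrite kn divr_ge0 ?mulr_ge0 ?subr_ge0 ?(ltW (b0 n)) ?(ltW m1) ?(ltW m0)//=.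
  rewrite ler_pM2r ?invr_gt0// ler_pM2r ?subr_gt0//.
  by have /andP[] := betaI n.
pose u n x := (C n - rV_potential L W (f n) x) / (coeff (beta n) * m).
pose p (t : R) := Num.max 0 t `^ (m - 1)^-1.
pose N := c `^ (m - 1) + (M + M) * k.
have p_ge0 : 0 < (m - 1)^-1 by rewrite invr_gt0 subr_gt0.
have cp : continuous p by exact: continuous_powR_max.
have uN n x : `|u n x| <= N.
  have [_ fa _ CM _] := fP n; have VM := rV_potential_bound cW x WM fa.
  have am0 : 0 < coeff (beta n) * m by rewrite mulr_gt0// coeff_gt0.
  (* C n is centred at the level whose best density is the uniform one. *)
  have -> : u n x = c `^ (m - 1) + (C n - coeff (beta n) * m * c `^ (m - 1)
      - rV_potential L W (f n) x) / (coeff (beta n) * m).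
    rewrite /u; move: (c `^ _) (rV_potential _ _ _ _) => q V.
    by move: am0; move: (coeff _ * m) => am am0; field; rewrite gt_eqF.
  rewrite (le_trans (ler_normD _ _))// ger0_norm ?powR_ge0// lerD2l normrM.
  have /andP[kn0 knk'] := knk n.
  rewrite ler_pM//; last by rewrite ger0_norm.
  by rewrite (le_trans (ler_normB _ _))// lerD.
have equi x (e : R) : 0 < e ->
    \forall x' \near x, forall n, `|u n x - u n x'| <= e.
  move=> e0; have ek : 0 < e / k by rewrite divr_gt0.
  have := rV_potential_equicontinuous m cW perW x ek.
  apply: filterS => x' Vxx' n; have [_ fa fc _ _] := fP n.
  rewrite /u -mulrBl opprB addrC addrA subrK normrM distrC.
  have /andP[kn0 knk'] := knk n.
  rewrite -[e](divfK (lt0r_neq0 k0)) ler_pM//; first exact: Vxx'.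
  by rewrite ger0_norm.
have [w wP] := @equicontinuous_cluster _ _ (closed_cell L) _ \oo u p N _
  (@compact_closed_cell R d L) cp uN equi.
have /choice[j jP] n : exists i, (n <= i)%N /\
    forall x, closed_cell L x -> `|p (u i x) - p (w x)| <= (n.+1%:R)^-1.
  have n0 : (0 : R) < (n.+1%:R)^-1 by rewrite invr_gt0.
  have [i ni ui] := wP _ [set i | (n <= i)%N] n0 (nbhs_infty_ge n).
  by exists i.
pose g n (x : T) := \1_(cell L d) x * p (u (j n) (vec x)).
pose h (x : T) := \1_(cell L d) x * p (w (vec x)).
have gE n : {ae mu, forall x, f (j n) x = g n x}.
  have [_ _ fc _] := fP (j n); apply: filterS => x fx.
  rewrite /g indicE; have [cx|ncx] := pselect (cell L d x).
    by rewrite mem_set// mul1r fx.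
  by rewrite memNset// mul0r fc.
have mg n : measurable_fun setT (g n).
  apply: measurable_funM; first exact: measurable_indic (measurable_cell L).
  have [_ [_ _ fi _ _] _ _ _] := fP (j n).
  apply: (@measurable_best_density _ _ _ _ _ m1
    (fun x => C (j n) - potential mu K (f (j n)) x)).
  apply: measurable_funB => //.
  exact: (@measurable_potential _ _ _ mu K M (measurable_kernel cW)
    (fun z => WM _)).
exists (p N), j, g, h; split.
- by move=> n; have [] := jP n.
- move=> n; split=> //; have [[dom rf] _ _ _ _] := fP (j n); split=> //.
  by move: rf (gE n); apply: filterS2 => x -> ->.
- move=> n x; have pN0 : 0 <= p N by exact: powR_ge0.
  have pu0 y : 0 <= p (u (j n) y) by exact: powR_ge0.
  have puN y : p (u (j n) y) <= p N.
    apply: ge0_ler_powR; rewrite ?nnegrE ?(ltW p_ge0)//.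
    - by rewrite le_max lexx.
    - by rewrite le_max lexx.
    rewrite ge_max !le_max lexx/= (le_trans (ler_norm _) (uN _ _)).
    by rewrite orbT.
  by rewrite /g indicE; case: (x \in _); rewrite ?mul1r ?mul0r ?pu0 ?puN ?lexx.
- move=> n; have [_ [mf _ fi <- _] _ _ _] := fP (j n).
  rewrite /Rintegral; congr fine; apply: ae_eq_integral => //.
  + exact/measurable_EFinP.
  + exact/measurable_EFinP.
  + by move: (gE n); apply: filterS => x ->.
- move=> n x; rewrite /g /h -mulrBr indicE.
  have [cx|ncx] := pselect (cell L d x).
    by rewrite mem_set// mul1r; have [_] := jP n; apply; exact: vec_cell.
  by rewrite memNset// mul0r normr0 invr_ge0.
Qed.

End compactness_of_minimisers.

(** * Passage to the limit *)

Section limit_of_energies.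
Context dT {T : measurableType dT} {R : realType}.
Variable mu : {finite_measure set T -> \bar R}.
Variables (K : T * T -> R) (M : R).
Hypothesis mK : measurable_fun setT K.
Hypothesis KM : forall z, `|K z| <= M.
Variables (m : R) (m1 : 1 < m).

Lemma energy_cvg (a_ : nat -> R) (a : R) (g : nat -> T -> R) (h : T -> R)
    (B : R) :
  a_ @ \oo --> a -> (forall n, measurable_fun setT (g n)) ->
  measurable_fun setT h -> (forall n x, 0 <= g n x <= B) ->
  (forall x, 0 <= h x <= B) -> (forall x, g ^~ x @ \oo --> h x) ->
  energy mu K m (a_ n) (g n) @[n --> \oo] --> energy mu K m a h.
Proof.
move=> aa mg mh gB hB gh; have m0 : 0 < m by apply: lt_trans m1.
have M0 : 0 <= M by exact: le_trans (normr_ge0 _) (KM (point, point)).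
have B0 : 0 <= B by have /andP[] := hB point; exact: le_trans.
have gN n x : `|g n x| <= B by have /andP[? ?] := gB n x; rewrite ger0_norm.
have hN x : `|h x| <= B by have /andP[? ?] := hB x; rewrite ger0_norm.
have gi n := bounded_integrable mu (mg n) (gN n).
have hi := bounded_integrable mu mh hN.
have potB (f : T -> R) x : measurable_fun setT f -> (forall x, `|f x| <= B) ->
    `|potential mu K f x| <= M * B * fine (mu setT).
  move=> mf fB; have fi := bounded_integrable mu mf fB.
  have Kfi := integrable_section mK KM x fi.
  rewrite (le_trans (le_normr_Rintegral _ _))// -Rintegral_cst//.
  apply: le_Rintegral => //.
  - exact: integrable_norm.
  - by apply: (@bounded_integrable _ _ _ mu _ `|M * B|).
  - by move=> y _; rewrite normrM ler_pM.
apply: cvgD.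
  apply: cvgM => //.
  apply: (@bounded_convergence _ _ _ mu _ _ (B `^ m)).
  - by move=> n; exact: measurable_funpowR.
  - exact: measurable_funpowR.
  - move=> n x; rewrite ger0_norm ?powR_ge0//; have /andP[g0 gB'] := gB n x.
    by apply: ge0_ler_powR; rewrite ?nnegrE// ltW.
  - move=> x; have max0 (f : T -> R) : 0 <= f x -> f x = Num.max 0 (f x).
      by move=> f0; rewrite max_r.
    have /andP[h0 _] := hB x; rewrite (max0 h)//.
    under eq_fun => n do rewrite (max0 (g n)) ?(andP (gB n x)).1//.
    apply: (@cvg_comp _ _ _ (g ^~ x) (fun t => Num.max 0 t `^ m) _
      (nbhs (h x))).
      exact: gh.
    exact: continuous_powR_max.
apply: cvgM; first exact: cvg_cst.
rewrite (interaction_potential mK KM)//.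
under eq_fun do rewrite (interaction_potential mK KM)//.
apply: (@bounded_convergence _ _ _ mu _ _ (B * (M * B * fine (mu setT)))).
- move=> n; apply: measurable_funM => //.
  exact: (measurable_potential mK KM).
- by apply: measurable_funM => //; exact: (measurable_potential mK KM).
- by move=> n x; rewrite normrM ler_pM// potB.
- move=> x; apply: cvgM; first exact: gh.
  apply: (@bounded_convergence _ _ _ mu _ _ (M * B)).
  + move=> n; apply: measurable_funM => //.
    by apply: measurableT_comp => //; exact: measurable_pair1.
  + apply: measurable_funM => //.
    by apply: measurableT_comp => //; exact: measurable_pair1.
  + by move=> n y; rewrite normrM ler_pM.
  + by move=> y; apply: cvgM; [exact: cvg_cst|exact: gh].
Qed.

(** Integrate the strict tangent inequality at c: its linear term has integral
    zero because g and c have the same mass. *)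
Lemma powR_strict_jensen (g : T -> R) (c : R) : 0 < c -> \int[mu]_x c = 1 ->
  admissible mu m g -> ~ {ae mu, forall x, g x = c} ->
  \int[mu]_x (c `^ m) < \int[mu]_x (g x `^ m).
Proof.
move=> c0 c1 [mg g0 gi g1 gm] gc; rewrite ltNge; apply/negP => le_gc; apply: gc.
have ci (r : R) : mu.-integrable setT (EFin \o cst r).
  by apply: (@bounded_integrable _ _ _ mu _ `|r|).
pose q := m * c `^ (m - 1).
pose D x := g x `^ m + (- q * g x + (q * c - c `^ m)).
have gap x : g x != c -> 0 < D x.
  by move=> /(powR_gt_tangent m1 c0 (g0 x)); rewrite /D /q; lra.
have gap0 x : g x = c -> D x = 0 by rewrite /D => ->; ring.
have D0 x : 0 <= D x by have [/gap0->//|/gap/ltW] := eqVneq (g x) c.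
have i1 := integrable_lincomb (- q) 1 gi (ci (q * c - c `^ m)).
have i2 := integrable_lincomb 1 1 gm i1.
have DE : D = (fun x => 1 * g x `^ m + 1 * (- q * g x + 1 * (q * c - c `^ m))).
  by apply/funext => x; rewrite /D; ring.
have iD : mu.-integrable setT (EFin \o D) by rewrite DE.
have ID : \int[mu]_x D x = \int[mu]_x (g x `^ m) - \int[mu]_x (c `^ m).
  rewrite DE (Rintegral_lincomb 1 1 gm i1).
  rewrite (Rintegral_lincomb _ _ gi (ci (q * c - c `^ m))) g1.
  move: c1; rewrite !Rintegral_cst// => c1.
  by rewrite mulrBl -(mulrA q) c1; ring.
have := @Rintegral_eq0_ae _ _ _ mu D iD D0.
rewrite ID subr_le0 => /(_ le_gc); apply: filterS => x Dx.
by apply/eqP; apply: contraT => /gap; rewrite Dx ltxx.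
Qed.

End limit_of_energies.

Section uniform_interaction.
Context {R : realType} {d : nat} (L : {posnum R}) (W : 'rV[R]_d -> R).
Hypotheses (cW : continuous W) (perW : torus_periodic L W).
Hypotheses (evW : even_coord W) (meanW : mean_zero L W).
Local Notation T := (Rd R d).
Local Notation mu := (torus_leb L d).

(** For x in the cell, the potential of a constant at x is a multiple of the
    integral of a translate of W, hence of the mean of W. *)
Lemma interaction_uniform (c : R) :
  interaction mu (kernel W) (fun=> c) (fun=> c) = 0.
Proof.
have [M WM] := torus_periodic_bounded cW perW.
have mK := measurable_kernel cW.
have KM (z : T * T) : `|kernel W z| <= M by exact: WM.
have ci : mu.-integrable setT (EFin \o cst c).
  by apply: (@bounded_integrable _ _ _ mu _ `|c|).
rewrite (interaction_potential mK KM)// /Rintegral.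
rewrite (@ae_eq_integral _ _ _ mu setT (cst 0%E)) ?integral0//.
  by have /measurable_int := integrable_potential mK KM ci ci.
exists (~` cell L d); split.
- by apply: measurableC; exact: measurable_cell.
- exact: torus_leb_cellC.
- move=> x /= h cx; apply: h => _; congr EFin; rewrite /potential.
  have Wi : mu.-integrable setT (EFin \o (fun y => kernel W (x, y))).
    apply: (@bounded_integrable _ _ _ mu _ M) => //.
    by apply: measurableT_comp => //; exact: measurable_pair1.
  rewrite RintegralZr// /Rintegral.
  under eq_integral do rewrite kernelC//.
  rewrite /kernel/= (@torus_shift R L d W (vec x)) ?meanW ?mul0r ?mulr0//.
  move=> i; rewrite mxE; have /andP[-> /ltW->//] := cx i.
Qed.

End uniform_interaction.

Theorem lemma5p16 (R : realType) (d : nat) (L : {posnum R})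
    (W : 'rV[R]_d -> R) (m betac : R)
    (hper : torus_periodic L W) (hC2 : C2 W) (heven : even_coord W)
    (hmean : mean_zero L W) (hm : 1 < m)
    (hdisc : discontinuous_transition_point L W m betac)
    (hfam : exists rho_ : R -> probability (Rd R d) R,
       minimiser_family L W m betac rho_ /\ limsup_dist L betac rho_ <> 0%E) :
  exists rhoc : probability (Rd R d) R,
    [/\ in_P L rhoc,
        ~ (rhoc ≡μ rho_inf L d),
        minimiser L W m betac rhoc,
        F_ L W m betac rhoc = F_ L W m betac (rho_inf L d) &
        [/\ (S_ L m betac (rho_inf L d) < S_ L m betac rhoc)%E,
            (E_ L W rhoc < E_ L W (rho_inf L d))%E &
            E_ L W (rho_inf L d) = 0%E]].
Proof.
have [[betac0 _ rho_inf_min _] _] := hdisc; have [cW _] := hC2.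
have [rho_ [rho_min limsup_neq0]] := hfam.
have [M WM] := torus_periodic_bounded cW hper.
have mK := measurable_kernel cW.
have KM (z : Rd R d * Rd R d) : `|kernel W z| <= M by exact: WM.
set mu := torus_leb L d; set c : R := L%:num ^- d.
pose coeff (beta : R) := beta^-1 / (m - 1).
have c0 : 0 < c by exact: uniform_density_gt0.
have dist0 beta : (0 <= Linfty_dist L (rho_ beta))%E by exact: Lnorm_ge0.
have [e e0 far] := limf_esup_neq0 _ dist0 limsup_neq0.
(* A sequence decreasing to the transition point along which the minimisers stay
   at distance at least e from the uniform density. *)
have /choice[beta betaP] n : exists beta : R,
    [/\ betac < beta <= betac + 1, `|beta - betac| <= (n.+1%:R)^-1 &
        (e%:E < Linfty_dist L (rho_ beta))%E].
  have n0 : (0 : R) < (n.+1%:R)^-1 by rewrite invr_gt0.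
  have n1 : (n.+1%:R)^-1 <= 1 :> R by rewrite invf_le1// ler1n.
  have [|b /andP[b1 b2] eb] := far [set b | betac < b <= betac + (n.+1%:R)^-1].
    near=> b; apply/andP; split; near: b; first exact: nbhs_right_gt.
    by apply: nbhs_right_le; rewrite ltrDl.
  exists b; split=> //; first by rewrite b1 (le_trans b2)// lerD2l.
  by rewrite ger0_norm ?subr_ge0 ?(ltW b1)// lerBlDl.
have beta_cvg : beta @ \oo --> betac.
  by apply: cvg_invSn_bound => n; have [] := betaP n.
have betaI n : betac < beta n <= betac + 1 by have [] := betaP n.
have b0 n : 0 < beta n by have /andP[/(lt_trans betac0)] := betaI n.
have bmin n : minimiser L W m (beta n) (rho_ (beta n)).
  by apply: rho_min; have /andP[] := betaI n.
have [B [j [g [h [jn gd gB g1 gh]]]]] :=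
  minimisers_precompact cW hper heven hm betac0 betaI bmin.
have g_cvg x : g ^~ x @ \oo --> h x.
  by apply: cvg_invSn_bound => n; exact: gh.
have mg n : measurable_fun setT (g n) by have [] := gd n.
have mh : measurable_fun setT h.
  by apply: (measurable_fun_cvg mg) => x _; exact: g_cvg.
have hB x : 0 <= h x <= B.
  have gcv : cvgn (g ^~ x) by apply/cvg_ex; exists (h x); exact: g_cvg.
  rewrite -(cvg_lim (@norm_hausdorff _ _) (g_cvg x)); apply/andP; split.
    by apply: limr_ge => //; apply: nearW => n; have /andP[] := gB n x.
  by apply: limr_le => //; apply: nearW => n; have /andP[] := gB n x.
have gN n x : `|g n x| <= B by have /andP[? ?] := gB n x; rewrite ger0_norm.
have h1 : \int[mu]_x h x = 1.
  have icvg := @bounded_convergence _ _ _ mu _ _ _ mg mh gN g_cvg.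
  apply: (cvg_unique (@norm_hausdorff _ _) icvg).
  have -> : (fun n => \int[mu]_x g n x) = cst 1.
    by apply/funext => n; exact: g1.
  exact: cvg_cst.
have ha : admissible mu m h by exact: (@bounded_admissible _ _ _ mu m hm h B).
have ga n : admissible mu m (g n).
  by apply: (@bounded_admissible _ _ _ mu m hm (g n) B) => //; exact: g1.
have ca : admissible mu m (fun=> c) by exact: admissible_uniform.
have [rhoc [rhocP rhocd]] := admissible_probability ha.
have [rho_infP rho_inf_le] := rho_inf_min.
have energy_le n : energy mu (kernel W) m (coeff (beta (j n))) (g n) <=
    energy mu (kernel W) m (coeff (beta (j n))) (fun=> c).
  have [_ /(_ _ rho_infP)] := bmin (j n).
  have [gdn _] := gd n.
  rewrite (F_density cW hper _ gdn (ga n)) F_uniform//.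
  by rewrite lee_fin lerD2r.
have betaj_cvg : (fun n => beta (j n)) @ \oo --> betac.
  apply: cvg_invSn_bound => n; have [_ bj _] := betaP (j n).
  by rewrite (le_trans bj)// lef_pV2 ?posrE// ler_nat ltnS.
have coeff_cvg : (fun n => coeff (beta (j n))) @ \oo --> coeff betac.
  by apply: cvgM; [apply: cvgV => //; rewrite gt_eqF|exact: cvg_cst].
(* Comparison with the uniform density suffices, since it is itself a minimiser
   at the transition point. *)
have limit_le : energy mu (kernel W) m (coeff betac) h <=
    energy mu (kernel W) m (coeff betac) (fun=> c).
  have cvg1 := @energy_cvg _ _ _ mu (kernel W) M mK KM m hm _ _ g h B
    coeff_cvg mg mh gB hB g_cvg.
  have cvg2 : energy mu (kernel W) m (coeff (beta (j n))) (fun=> c) @[n --> \oo]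
      --> energy mu (kernel W) m (coeff betac) (fun=> c).
    apply: (@energy_cvg _ _ _ mu (kernel W) M mK KM m hm _ _
      (fun _ _ => c) (fun=> c) c) => //.
    - by move=> _ _; rewrite lexx ltW.
    - by move=> _; rewrite lexx ltW.
    - by move=> x; exact: cvg_cst.
  apply: (ler_cvg_to cvg1 cvg2); apply: nearW => n; exact: energy_le.
have Frhoc := F_density cW hper betac rhocd ha.
have Finf := F_uniform (L := L) cW hper hm betac.
have Fle : (F_ L W m betac rhoc <= F_ L W m betac (rho_inf L d))%E.
  by rewrite Frhoc Finf lee_fin lerD2r.
have Feq : F_ L W m betac rhoc = F_ L W m betac (rho_inf L d).
  apply/eqP; rewrite eq_le Fle/=.
  exact: rho_inf_le.
(* Uniform convergence is essential here: the distance to the uniform density in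
   the essential supremum norm stays above e along the sequence. *)
have h_neq_c : ~ {ae mu, forall x, h x = c}.
  move=> hc; have [n ne] := invSn_lt e0.
  have [_ _ edist] := betaP (j n); have [gdn _] := gd n.
  have : (Linfty_dist L (rho_ (beta (j n))) <= (n.+1%:R^-1)%:E)%E.
    apply: (Linfty_dist_le gdn); move: hc; apply: filterS => x hx.
    by rewrite -[X in _ - X]hx; exact: gh.
  by move=> /(lt_le_trans edist); rewrite lte_fin ltNge (ltW ne).
have powlt := powR_strict_jensen hm c0 (@Rintegral_uniform R d L) ha h_neq_c.
have E0 := interaction_uniform cW hper heven hmean c.
have ac0 : 0 < coeff betac by exact: coeff_gt0.
have [_ _ hi _ hmi] := ha; have [mc _ ci _ cmi] := ca.
have Erho := E_density cW hper rhocd mh hi.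
have Einf : E_ L W (rho_inf L d) = 0%E.
  by rewrite (E_density cW hper (rho_inf_density L) mc ci) E0 mulr0.
have Sval f rho : has_density L rho f -> admissible mu m f ->
    S_ L m betac rho = (coeff betac * (\int[mu]_x (f x `^ m)) - coeff betac)%:E.
  move=> rf [mf _ _ _ fm]; rewrite (S_density m betac rf mf).
  by rewrite -[X in (_ * X)%E]fineK ?(integrable_fin_num measurableT fm).
exists rhoc; split.
- exact: rhocP.
- move=> rhoc_eq; apply: h_neq_c.
  have [_ rc] : has_density L rhoc (fun=> c).
    apply: has_densityP ci _ => A mA.
    by rewrite rhoc_eq// integral_cst.
  by have [_] := rhocd; move: rc; apply: filterS2 => x -> [].
- by split=> [|nu nuP]; [exact: rhocP|rewrite Feq; exact: rho_inf_le].
- exact: Feq.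
- split; last exact: Einf.
  + rewrite (Sval _ _ rhocd ha) (Sval _ _ (rho_inf_density L) ca).
    by rewrite lte_fin ltrD2r ltr_pM2l.
  + rewrite Einf Erho lte_fin.
    move: limit_le; rewrite /energy E0 mulr0 addr0 -lerBrDl.
    by move=> /le_lt_trans; apply; rewrite subr_lt0 ltr_pM2l.
Unshelve. all: by end_near. Qed.
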